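(* Let $c\in\mathbb C$ be a regular constant, let $n\ge0$ be an integer, write $n=mq+r$ with $q\ge0$, $0\le r\le m-1$, and assume $c\notin\{1,2,\dots,q\}$. Define the linear functional $\varphi$ on the space of homogeneous polynomials of degree $2n$ in $z,\bar z$ by $\varphi(z^n\bar z^n)=1$, $\varphi(z^{n-mk}\bar z^{n+mk})=\varphi(z^{n+mk}\bar z^{n-mk})=(-1)^{mk}\frac{c(c+1)\cdots(c+k-1)}{(1-c)(2-c)\cdots(k-c)}$ for $1\le k\le q$, and $\varphi(z^a\bar z^b)=0$ for all other monomials with $a+b=2n$. Then the degree-$2n$ homogeneous component of the ideal $J_{n+1,c}$ is exactly the kernel of $\varphi$. Equivalently, the standard Frobenius algebra $\mathbb C[z,\bar z]/J_{n+1,c}$ (of degree $2n$) has characteristic polynomial, up to a scalar, $$p_{2n,c}=z^{(n)}\bar z^{(n)}+\sum_{k=1}^q(-1)^{mk}\frac{c(c+1)\cdots(c+k-1)}{(1-c)(2-c)\cdots(k-c)}\big(z^{(n-mk)}\bar z^{(n+mk)}+z^{(n+mk)}\bar z^{(n-mk)}\big),$$ where $x^{(a)}=x^a/a!$.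
   Context: Let $m\ge2$, $\zeta=e^{2\pi i/m}$, and let $z,\bar z$ be independent variables. For $j=0,\dots,m-1$ let $s_j$ be the algebra automorphism of $\mathbb C[z,\bar z]$ with $s_j(z)=-\zeta^j\bar z$, $s_j(\bar z)=-\zeta^{-j}z$. For constant $c$ define Dunkl operators $Y(q)=\frac{\partial q}{\partial z}-c\sum_j\frac{q-s_j(q)}{z+\zeta^j\bar z}$, $\bar Y(q)=\frac{\partial q}{\partial\bar z}-c\sum_j\frac{q-s_j(q)}{\bar z+\zeta^{-j}z}$, $F=-Y\bar Y$; $\mathcal{QH}^{(c)}_{n+1}$ is the space of homogeneous degree-$(n+1)$ polynomials killed by $F$, and $J_{n+1,c}$ is the ideal generated by it. $c$ is regular if there is no nonzero homogeneous polynomial $P$ of positive degree with $Y(P)=\bar Y(P)=0$. The characteristic polynomial of a graded quotient $A=\mathbb C[z,\bar z]/J$ with one-dimensional top degree $N$ is the linear functional on degree-$N$ polynomials with kernel $J_N$, written as the polynomial $\sum_{a+b=N}\varphi(z^a\bar z^b)\,z^{(a)}\bar z^{(b)}$ (divided powers, so that $z^{(a)}\bar z^{(b)}$ is dual to the monomial $z^a\bar z^b$). *)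

(* Defs.v *)
(* Polynomials in z, zb over a numeric algebraically closed
   field C are represented as {poly {poly C}}: the outer variable is z,
   the inner variable (embedded as a constant) is zb. *)
From HB Require Import structures.
From mathcomp Require Import all_boot all_order all_algebra.
Set Implicit Arguments. Unset Strict Implicit. Unset Printing Implicit Defensive.
Import Order.TTheory GRing.Theory Num.Theory.
Local Open Scope ring_scope.

Section Dunkl.
Variable C : numClosedFieldType.

Definition P2 := {poly {poly C}}.

Definition cst (a : C) : P2 := a%:P%:P.
Definition zv : P2 := 'X.
Definition zbv : P2 := ('X)%:P.

Definition coef2 (p : P2) (a b : nat) : C := (p`_a)`_b.

Definition homog (d : nat) (p : P2) : Prop :=
  forall a b : nat, (a + b != d)%N -> coef2 p a b = 0.

Definition eval2 (p : P2) (X Y : P2) : P2 :=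
  (map_poly (fun s : {poly C} => (map_poly cst s).[Y]) p).[X].

Definition dz (p : P2) : P2 := p^`().
Definition dzb (p : P2) : P2 := map_poly (fun s : {poly C} => s^`()) p.

Definition refl (zeta : C) (j : nat) (p : P2) : P2 :=
  eval2 p (- (cst (zeta ^+ j) * zbv)) (- (cst (zeta ^- j) * zv)).

(* Dunkl operators Y and Ybar (the divisions are exact) *)
Definition DY (m : nat) (zeta c : C) (p : P2) : P2 :=
  dz p - cst c * \sum_(j < m)
     ((p - refl zeta j p) %/ (zv + cst (zeta ^+ j) * zbv)).
Definition DYbar (m : nat) (zeta c : C) (p : P2) : P2 :=
  dzb p - cst c * \sum_(j < m)
     ((p - refl zeta j p) %/ (zbv + cst (zeta ^- j) * zv)).

Definition DF (m : nat) (zeta c : C) (p : P2) : P2 :=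
  - DY m zeta c (DYbar m zeta c p).

Definition QH (m : nat) (zeta c : C) (d : nat) (p : P2) : Prop :=
  homog d p /\ DF m zeta c p = 0.

Definition inJ (m : nat) (zeta c : C) (d : nat) (p : P2) : Prop :=
  exists s : seq (P2 * P2),
    (forall x, x \in s -> QH m zeta c d x.2) /\
    p = \sum_(x <- s) x.1 * x.2.

Definition regular (m : nat) (zeta c : C) : Prop :=
  forall (d : nat) (p : P2), (0 < d)%N -> homog d p ->
    DY m zeta c p = 0 -> DYbar m zeta c p = 0 -> p = 0.

Definition wt (m : nat) (c : C) (k : nat) : C :=
  (-1) ^+ (m * k) * (\prod_(i < k) (c + i%:R)) /
  (\prod_(i < k) (i.+1%:R - c)).

Definition phi (m : nat) (c : C) (n : nat) (p : P2) : C :=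
  coef2 p n n +
  \sum_(1 <= k < (n %/ m).+1)
     wt m c k * (coef2 p (n - m * k) (n + m * k) + coef2 p (n + m * k) (n - m * k)).

End Dunkl.

(* Main.v *)
Require Import Defs.
From HB Require Import structures.
From mathcomp Require Import all_boot all_order all_algebra.
From mathcomp Require Import ring zify.
Import Order.TTheory GRing.Theory Num.Theory.
Set Implicit Arguments. Unset Strict Implicit. Unset Printing Implicit Defensive.
Local Open Scope ring_scope.

(* phi is, up to normalisation, integration over the unit circle against
   |z^m - (-zb)^m|^(-2c), the weight of the Dunkl operators.  It extends to a linear
   functional Lambda on all polynomials with Lambda(z zb p) = Lambda(p), and
   integration by parts reads, for deg(fg) = 2s - 1,
     Lambda(Y f * g) + Lambda(f * Y g) = (s - cm) Lambda(zb f g),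
   similarly for Ybar.
   - Together with Euler's identity this shows Lambda(gh) = 0 for h in QH_(n+1) and
     deg g < n, provided s - cm <> 0 for 1 <= s <= n.  If m | s this is the
     assumption on c; otherwise c = s/m would produce a singular polynomial.
   - The radical of (f, g) |-> Lambda(fg) on degree l <= n is stable under Y and Ybar,
     so by induction on l and regularity it vanishes.
   - QH_(n+1) has dimension >= 2 since F maps degree n+1 to degree n-1.  Two
     independent elements h1, h2 have no common linear factor ell: otherwise both
     quotients would be Lambda-orthogonal to the hyperplane ell * C[z,zb]_(n-1).
     Hence C[z,zb]_(n-1) h1 + C[z,zb]_(n-1) h2 has dimension 2n and is all of
     ker phi. *)

(** * Polynomials in two variables *)

Section Bivariate.
Variable C : numClosedFieldType.
Implicit Types (p q f g : P2 C) (a b c : C) (i j k d e : nat).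

Definition mon i j : P2 C := zv C ^+ i * zbv C ^+ j.

Lemma cstE a : cst a = (polyC \o polyC) a. Proof. by []. Qed.
Lemma cst0 : cst (0 : C) = 0. Proof. by rewrite cstE rmorph0. Qed.
Lemma cst1 : cst (1 : C) = 1. Proof. by rewrite cstE rmorph1. Qed.
Lemma cstM a b : cst (a * b) = cst a * cst b. Proof. by rewrite !cstE rmorphM. Qed.
Lemma cstD a b : cst (a + b) = cst a + cst b. Proof. by rewrite !cstE rmorphD. Qed.
Lemma cstN a : cst (- a) = - cst a. Proof. by rewrite !cstE rmorphN. Qed.
Lemma cstX a k : cst (a ^+ k) = cst a ^+ k. Proof. by rewrite !cstE rmorphXn. Qed.
Lemma cst_nat k : cst (k%:R : C) = k%:R. Proof. by rewrite cstE rmorph_nat. Qed.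
Lemma cst_sum (I : Type) (r : seq I) (P : pred I) (F : I -> C) :
  cst (\sum_(i <- r | P i) F i) = \sum_(i <- r | P i) cst (F i).
Proof. by rewrite cstE rmorph_sum. Qed.

Lemma coef2D p q i j : coef2 (p + q) i j = coef2 p i j + coef2 q i j.
Proof. by rewrite /coef2 !coefD. Qed.
Lemma coef2N p i j : coef2 (- p) i j = - coef2 p i j.
Proof. by rewrite /coef2 !coefN. Qed.
Lemma coef20 i j : coef2 (0 : P2 C) i j = 0.
Proof. by rewrite /coef2 !coef0. Qed.
Lemma coef2_cstM a p i j : coef2 (cst a * p) i j = a * coef2 p i j.
Proof. by rewrite /coef2 !coefCM. Qed.
Lemma coef2_sum (I : Type) (r : seq I) (P : pred I) (F : I -> P2 C) i j :
  coef2 (\sum_(x <- r | P x) F x) i j = \sum_(x <- r | P x) coef2 (F x) i j.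
Proof. by rewrite /coef2 coef_sum coef_sum. Qed.
Lemma coef2_mon i j k l : coef2 (mon i j) k l = ((k == i) && (l == j))%:R.
Proof.
rewrite /coef2 /mon /zbv -rmorphXn coefMC coefXn.
by case: eqP => _ /=; rewrite ?mul1r ?mul0r ?coef0 // coefXn.
Qed.
Lemma coef2_zM p i j : coef2 (zv C * p) i j = if i is i'.+1 then coef2 p i' j else 0.
Proof. by rewrite /coef2 coefXM; case: i => [|i] //=; rewrite coef0. Qed.
Lemma coef2_zbM p i j : coef2 (zbv C * p) i j = if j is j'.+1 then coef2 p i j' else 0.
Proof. by rewrite /coef2 coefCM coefXM; case: j. Qed.
Lemma coef2_swap p i j : coef2 (swapXY p) i j = coef2 p j i.
Proof. by rewrite /coef2 coef_swapXY. Qed.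

Lemma P2_eqP p q : (forall i j, coef2 p i j = coef2 q i j) -> p = q.
Proof. by move=> h; apply/polyP => i; apply/polyP => j; apply: h. Qed.

Lemma monM i j k l : mon i j * mon k l = mon (i + k) (j + l).
Proof. by rewrite /mon !exprD; ring. Qed.
Lemma mon00 : mon 0 0 = 1. Proof. by rewrite /mon !expr0 mul1r. Qed.
Lemma zmon i j : zv C * mon i j = mon i.+1 j.
Proof. by rewrite /mon mulrA -exprS. Qed.
Lemma zbmon i j : zbv C * mon i j = mon i j.+1.
Proof. by rewrite /mon mulrCA -exprS. Qed.

Lemma P2E p : p = \sum_(i < size p) \sum_(j < sizeY p) cst (coef2 p i j) * mon i j.
Proof.
apply: P2_eqP => k l; rewrite coef2_sum.
under eq_bigr => i _.
  rewrite coef2_sum; under eq_bigr => j _ do rewrite coef2_cstM coef2_mon.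
  over.
case: (ltnP k (size p)) => hk; last first.
  transitivity (0 : C); first by rewrite /coef2 (nth_default 0 hk) coef0.
  symmetry; apply: big1 => i _; apply: big1 => j _.
  case: eqP => [e|]; last by rewrite mulr0.
  by move: (ltn_ord i); rewrite -e ltnNge hk.
case: (ltnP l (sizeY p)) => hl; last first.
  transitivity (0 : C).
    by rewrite /coef2 nth_default // (leq_trans (max_size_coefXY p k)).
  symmetry; apply: big1 => i _; apply: big1 => j _; rewrite andbC.
  case: eqP => [e|]; last by rewrite mulr0.
  by move: (ltn_ord j); rewrite -e ltnNge hl.
rewrite (bigD1 (Ordinal hk)) //= (bigD1 (Ordinal hl)) //= !eqxx mulr1.
rewrite !big1 ?addr0 //.
  move=> i ik; rewrite big1 // => j _.
  by rewrite [k == i]eq_sym -[k]/(val (Ordinal hk)) val_eqE (negPf ik) mulr0.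
move=> j jl.
by rewrite [l == j]eq_sym -[l]/(val (Ordinal hl)) val_eqE (negPf jl) mulr0.
Qed.

Lemma P2_ind (P : P2 C -> Prop) :
  P 0 -> (forall p q, P p -> P q -> P (p + q)) ->
  (forall a i j, P (cst a * mon i j)) -> forall p, P p.
Proof.
move=> P0 PD PM p; rewrite (P2E p).
by apply: (big_ind P) => // i _; apply: (big_ind P) => // j _; apply: PM.
Qed.

Lemma homogE d p : homog d p ->
  p = \sum_(i < d.+1) cst (coef2 p i (d - i)) * mon i (d - i).
Proof.
move=> hp; apply: P2_eqP => k l; rewrite coef2_sum.
under eq_bigr => i _ do rewrite coef2_cstM coef2_mon.
case: (eqVneq (k + l)%N d) => [e|ne]; last first.
  rewrite hp // big1 // => i _; case: andP => [[/eqP ek /eqP el]|]; last by rewrite mulr0.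
  by move: ne; rewrite ek el subnKC ?eqxx // -ltnS.
have hk : (k < d.+1)%N by lia.
rewrite (bigD1 (Ordinal hk)) //= big1 ?addr0.
  by rewrite (_ : (d - k)%N = l) ?eqxx ?mulr1 //; lia.
move=> i ik; rewrite [k == i]eq_sym -[k]/(val (Ordinal hk)) val_eqE (negPf ik).
by rewrite mulr0.
Qed.

Lemma homog_mon i j : homog (i + j) (mon i j).
Proof. by move=> k l kl; rewrite coef2_mon; case: andP => // -[/eqP e /eqP e']; lia. Qed.
Lemma homog0 d : homog d (0 : P2 C). Proof. by move=> i j _; rewrite coef20. Qed.
Lemma homogD d p q : homog d p -> homog d q -> homog d (p + q).
Proof. by move=> hp hq i j ij; rewrite coef2D hp ?hq ?addr0. Qed.
Lemma homogN d p : homog d p -> homog d (- p).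
Proof. by move=> hp i j ij; rewrite coef2N hp ?oppr0. Qed.
Lemma homogZ d a p : homog d p -> homog d (cst a * p).
Proof. by move=> hp i j ij; rewrite coef2_cstM hp ?mulr0. Qed.
Lemma homog_sum (I : Type) (r : seq I) (P : pred I) (F : I -> P2 C) d :
  (forall x, P x -> homog d (F x)) -> homog d (\sum_(x <- r | P x) F x).
Proof. by move=> h; apply: big_ind => //; [apply: homog0 | apply: homogD]. Qed.

Lemma homog_ind d (P : P2 C -> Prop) :
  P 0 -> (forall p q, P p -> P q -> P (p + q)) ->
  (forall a i j, (i + j = d)%N -> P (cst a * mon i j)) -> forall p, homog d p -> P p.
Proof.
move=> P0 PD PM p /homogE ->.
by apply: (big_ind P) => // i _; apply: PM; rewrite subnKC // -ltnS.
Qed.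

Lemma homogM d e p q : homog d p -> homog e q -> homog (d + e) (p * q).
Proof.
move=> hp hq; elim/homog_ind: hp => [|p1 p2 h1 h2|a i j ij].
- by rewrite mul0r; apply: homog0.
- by rewrite mulrDl; apply: homogD.
elim/homog_ind: hq => [|q1 q2 h1 h2|b k l kl].
- by rewrite mulr0; apply: homog0.
- by rewrite mulrDr; apply: homogD.
rewrite mulrACA -cstM monM; apply: homogZ.
by rewrite -ij -kl addnACA; apply: homog_mon.
Qed.
Lemma homog_z d p : homog d p -> homog d.+1 (zv C * p).
Proof.
by move=> hp [|i] j ij; rewrite coef2_zM // hp //; apply: contra ij => /eqP <-.
Qed.
Lemma homog_zb d p : homog d p -> homog d.+1 (zbv C * p).
Proof.
move=> hp i [|j] ij; rewrite coef2_zbM // hp //; apply: contra ij => /eqP <-.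
by rewrite addnS.
Qed.
Lemma homog0E p : homog 0 p -> p = cst (coef2 p 0 0).
Proof. by move/homogE ->; rewrite big_ord1 coef2_cstM coef2_mon mon00 !mulr1. Qed.

Lemma rmorph_P2_ext (A : pzSemiRingType) (s t : {rmorphism P2 C -> A}) :
  (forall a, s (cst a) = t (cst a)) -> s (zv C) = t (zv C) -> s (zbv C) = t (zbv C) ->
  s =1 t.
Proof.
move=> hc hz hb; elim/P2_ind => [|p q hp hq|a i j]; first by rewrite !rmorph0.
  by rewrite !rmorphD hp hq.
by rewrite /mon !rmorphM !rmorphXn hc hz hb.
Qed.

End Bivariate.

(** * Reflections and divided differences *)

Section Reflection.
Variables (C : numClosedFieldType) (zeta : C).
Implicit Types (p q f g : P2 C) (a b c : C) (i j k d e : nat).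

(** [refl] is convertible to a composite of evaluations and coefficientwise maps, all of them ring
    morphisms. *)
Fact refl_zmod_morphism j : zmod_morphism (refl zeta j).
Proof.
move=> p q; pose X : P2 C := - (cst (zeta ^+ j) * zbv C).
pose Y : P2 C := - (cst (zeta ^- j) * zv C).
exact: (rmorphB (horner_eval X \o map_poly (horner_eval Y \o map_poly (polyC \o polyC)))).
Qed.
Fact refl_monoid_morphism j : monoid_morphism (refl zeta j).
Proof.
pose X : P2 C := - (cst (zeta ^+ j) * zbv C).
pose Y : P2 C := - (cst (zeta ^- j) * zv C).
pose s : {rmorphism P2 C -> P2 C} :=
  horner_eval X \o map_poly (horner_eval Y \o map_poly (polyC \o polyC)).
split; [exact: (rmorph1 s) | exact: (rmorphM s)].
Qed.
HB.instance Definition _ j :=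
  GRing.isZmodMorphism.Build (P2 C) (P2 C) (refl zeta j) (refl_zmod_morphism j).
HB.instance Definition _ j :=
  GRing.isMonoidMorphism.Build (P2 C) (P2 C) (refl zeta j) (refl_monoid_morphism j).

Lemma refl_cst j a : refl zeta j (cst a) = cst a.
Proof.
rewrite /refl /eval2 /cst; pose Y : P2 C := - (cst (zeta ^- j) * zv C).
have h : map_poly (fun s : {poly C} => (map_poly (@cst C) s).[Y]) a%:P%:P = (cst a)%:P.
  pose s : {rmorphism {poly C} -> P2 C} := horner_eval Y \o map_poly (polyC \o polyC).
  rewrite (map_polyC s) /= /horner_eval map_polyC /= hornerC //.
by rewrite h hornerC.
Qed.
Lemma refl_z j : refl zeta j (zv C) = - (cst (zeta ^+ j) * zbv C).
Proof.
rewrite /refl /eval2 /zv; pose Y : P2 C := - (cst (zeta ^- j) * zv C).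
pose s : {rmorphism {poly C} -> P2 C} := horner_eval Y \o map_poly (polyC \o polyC).
by rewrite (map_polyX s) hornerX.
Qed.
Lemma refl_zb j : refl zeta j (zbv C) = - (cst (zeta ^- j) * zv C).
Proof.
rewrite /refl /eval2 {2}/zbv; pose Y : P2 C := - (cst (zeta ^- j) * zv C).
pose s : {rmorphism {poly C} -> P2 C} := horner_eval Y \o map_poly (polyC \o polyC).
by rewrite (map_polyC s) hornerC /= /horner_eval (map_polyX (polyC \o polyC)) hornerX.
Qed.

Hypothesis zeta0 : zeta != 0.
Let zj0 j : zeta ^+ j != 0. Proof. by rewrite expf_neq0. Qed.
Let cstV j : cst (zeta ^+ j) * cst (zeta ^- j) = 1.
Proof. by rewrite -cstM divff ?cst1. Qed.

(** The linear form whose zero line is the mirror of the [j]-th reflection. *)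
Definition alpha j : P2 C := zv C + cst (zeta ^+ j) * zbv C.

(** Coefficients lie in [{poly C}], which is not a field; being monic in z is what makes division by
    [alpha j] exact on its multiples. *)
Lemma alpha_monic j : alpha j \is monic.
Proof.
have -> : alpha j = 'X - (- ((zeta ^+ j)%:P * 'X))%:P by rewrite rmorphN opprK rmorphM.
exact: monicXsubC.
Qed.
Lemma alpha_neq0 j : alpha j != 0.
Proof. exact: monic_neq0 (alpha_monic j). Qed.

Lemma reflK j : involutive (refl zeta j).
Proof.
move=> p; apply: (@rmorph_P2_ext C _ (refl zeta j \o refl zeta j) idfun) p => /=.
- by move=> a; rewrite !refl_cst.
- rewrite refl_z rmorphN /= rmorphM /= refl_cst refl_zb /=; have := cstV j; move=> h.
  by rewrite mulrN opprK mulrA h mul1r.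
- rewrite refl_zb rmorphN /= rmorphM /= refl_cst refl_z /=; have := cstV j; move=> h.
  by rewrite mulrN opprK mulrA [cst _ * _]mulrC h mul1r.
Qed.

Lemma refl_alpha j : refl zeta j (alpha j) = - alpha j.
Proof.
rewrite /alpha rmorphD /= rmorphM /= refl_cst refl_z refl_zb /=.
by rewrite mulrN mulrA cstV mul1r opprD addrC.
Qed.

(** By pq - s(p)s(q) = (p - s(p)) q + s(p) (q - s(q)), divisibility passes to products; it holds for
    constants, z and zb. *)
Lemma alpha_dvd j p : exists q, p - refl zeta j p = alpha j * q.
Proof.
elim/P2_ind: p => [|p q [p' hp] [q' hq]|a k l].
- by exists 0; rewrite rmorph0 subr0 mulr0.
- by exists (p' + q'); rewrite rmorphD mulrDr -hp -hq; ring.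
have M p q : (exists p', p - refl zeta j p = alpha j * p') ->
    (exists q', q - refl zeta j q = alpha j * q') ->
    exists r, p * q - refl zeta j (p * q) = alpha j * r.
  move=> [p' hp] [q' hq]; exists (p' * q + refl zeta j p * q').
  by rewrite mulrDr mulrA -hp mulrCA -hq rmorphM; ring.
have X p k' : (exists p', p - refl zeta j p = alpha j * p') ->
    exists r, p ^+ k' - refl zeta j (p ^+ k') = alpha j * r.
  move=> hp; elim: k' => [|k' IH]; first by exists 0; rewrite rmorph1 subrr mulr0.
  by rewrite exprS; apply: M.
apply: (M _ _); first by exists 0; rewrite refl_cst subrr mulr0.
apply: (M _ _); apply: (X _ _).
  by exists 1; rewrite refl_z opprK mulr1.
by exists (cst (zeta ^- j)); rewrite refl_zb /alpha mulrDl mulrAC cstV mul1r; ring.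
Qed.

Definition divdiff j p : P2 C := (p - refl zeta j p) %/ alpha j.

Lemma divdiffE j p q : p - refl zeta j p = alpha j * q -> divdiff j p = q.
Proof.
move=> h; rewrite /divdiff h mulrC.
exact: (Pdiv.IdomainMonic.mulpK (alpha_monic j)).
Qed.
Lemma divdiffK j p : alpha j * divdiff j p = p - refl zeta j p.
Proof. by have [q h] := alpha_dvd j p; rewrite (divdiffE h). Qed.

(** The divisor is zeta^-j times [alpha j], so the quotient gains the factor zeta^j. *)
Lemma divdiffbE j p :
  (p - refl zeta j p) %/ (zbv C + cst (zeta ^- j) * zv C) = cst (zeta ^+ j) * divdiff j p.
Proof.
rewrite -divdiffK; have := cstV j => h.
rewrite (_ : alpha j * _ = cst (zeta ^+ j) * divdiff j p * (zbv C + cst (zeta ^- j) * zv C)).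
  apply: Pdiv.IdomainUnit.mulpK.
  have -> : zbv C + cst (zeta ^- j) * zv C = cst (zeta ^- j) * alpha j.
    by rewrite /alpha mulrDr mulrA [cst _ * cst (zeta ^+ j)]mulrC h mul1r addrC.
  rewrite lead_coefM (monicP (alpha_monic j)) mulr1 lead_coefC.
  by rewrite poly_unitE size_polyC coefC eqxx /= unitfE invr_eq0 zj0.
rewrite /alpha; move: (divdiff j p) => D.
move: (cst (zeta ^+ j)) (cst (zeta ^- j)) h => u v h.
by transitivity ((u * v) * zv C * D + u * zbv C * D); [rewrite h; ring | ring].
Qed.

Lemma divdiffD j p q : divdiff j (p + q) = divdiff j p + divdiff j q.
Proof. by apply: divdiffE; rewrite mulrDr !divdiffK rmorphD; ring. Qed.
Lemma divdiffZ j a p : divdiff j (cst a * p) = cst a * divdiff j p.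
Proof. by apply: divdiffE; rewrite mulrCA divdiffK rmorphM /= refl_cst; ring. Qed.
(** The twisted Leibniz rule, made symmetric by writing s_j(p) as p - alpha_j D_j(p). *)
Lemma divdiffM j p q : divdiff j (p * q) =
  divdiff j p * q + p * divdiff j q - alpha j * divdiff j p * divdiff j q.
Proof.
apply: divdiffE.
have -> : alpha j * (divdiff j p * q + p * divdiff j q - alpha j * divdiff j p * divdiff j q)
  = (alpha j * divdiff j p) * q + p * (alpha j * divdiff j q)
    - (alpha j * divdiff j p) * (alpha j * divdiff j q) by ring.
by rewrite !divdiffK rmorphM /=; ring.
Qed.
Lemma refl_divdiff j p : refl zeta j (divdiff j p) = divdiff j p.
Proof.
apply: (mulfI (alpha_neq0 j)); apply: oppr_inj.
by rewrite -mulNr -refl_alpha -rmorphM divdiffK rmorphB /= reflK opprB.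
Qed.

Lemma refl_mon j k l :
  refl zeta j (mon C k l) =
  cst ((-1) ^+ (k + l) * zeta ^+ (j * k) * zeta ^- (j * l)) * mon C l k.
Proof.
have -> : refl zeta j (mon C k l) =
    refl zeta j (zv C) ^+ k * refl zeta j (zbv C) ^+ l by rewrite rmorphM !rmorphXn.
rewrite refl_z refl_zb -!mulNr -!cstN !exprMn -!cstX /mon.
rewrite (exprNn _ k) (exprNn _ l) exprVn -!exprM exprD.
by rewrite !cstM; ring.
Qed.

Let refl_zzb j k : (refl zeta j (zv C) * refl zeta j (zbv C)) ^+ k = mon C k k.
Proof. by rewrite refl_z refl_zb mulrNN mulrACA cstV mul1r mulrC exprMn. Qed.

(** The invariant factor (z zb)^k comes out, and z^d - s_j(z)^d is a geometric sum times z - s_j(z)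
    = alpha_j. *)
Lemma divdiff_mon_ge j k d : divdiff j (mon C (k + d) k) =
  \sum_(i < d) cst ((-1) ^+ i * zeta ^+ (j * i)) * mon C (k + (d.-1 - i)) (k + i).
Proof.
apply: divdiffE.
have -> : refl zeta j (mon C (k + d) k) = mon C k k * refl zeta j (zv C) ^+ d.
  by rewrite rmorphM !rmorphXn /= exprD -(refl_zzb j) exprMn; ring.
have -> : mon C (k + d) k = mon C k k * zv C ^+ d by rewrite /mon exprD; ring.
rewrite -mulrBr subrXX refl_z opprK -/(alpha j) mulrCA; congr (_ * _).
rewrite mulr_sumr; apply: eq_bigr => i _.
rewrite -mulNr -cstN exprMn -cstX (exprNn (zeta ^+ j)) -exprM /mon !exprD; ring.
Qed.

Lemma divdiff_mon_le j k d : divdiff j (mon C k (k + d)) =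
  \sum_(i < d) cst ((-1) ^+ i * zeta ^- (j * i.+1)) * mon C (k + i) (k + (d.-1 - i)).
Proof.
apply: divdiffE.
have -> : refl zeta j (mon C k (k + d)) = mon C k k * refl zeta j (zbv C) ^+ d.
  by rewrite rmorphM !rmorphXn /= exprD -(refl_zzb j) exprMn; ring.
have -> : mon C k (k + d) = mon C k k * zbv C ^+ d by rewrite /mon exprD; ring.
rewrite -mulrBr subrXX refl_zb opprK.
have -> : zbv C + cst (zeta ^- j) * zv C = alpha j * cst (zeta ^- j).
  by rewrite /alpha mulrDl mulrAC cstV; ring.
rewrite mulrCA -mulrA; congr (_ * _).
rewrite !mulr_sumr; apply: eq_bigr => i _.
rewrite -mulNr -cstN exprMn -cstX (exprNn (zeta ^- j)) exprVn -exprM mulnS exprD invfM /mon !cstM.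
by rewrite !exprD; ring.
Qed.
End Reflection.

(** * Sums over roots of unity *)

Lemma sum_primitive_root (C : fieldType) m (w : C) i : m.-primitive_root w ->
  \sum_(j < m) w ^+ (j * i) = if (m %| i)%N then m%:R else 0.
Proof.
move=> hw; under eq_bigr => j _ do rewrite mulnC exprM.
case: ifP => hi.
  have -> : w ^+ i = 1 by apply/eqP; rewrite -(prim_order_dvd hw).
  by under eq_bigr => j _ do rewrite expr1n; rewrite sumr_const card_ord.
have h1 : w ^+ i - 1 != 0 by rewrite subr_eq0 -(prim_order_dvd hw) hi.
apply: (mulfI h1); rewrite -subrX1 mulr0 -exprM mulnC exprM (prim_expr_order hw).
by rewrite expr1n subrr.
Qed.

Lemma sum_dvdn (V : nmodType) m k (F : nat -> V) : (0 < m)%N ->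
  \sum_(i < (m * k).+1 | (m %| i)%N) F i = \sum_(i < k.+1) F (m * i)%N.
Proof.
move=> m0; rewrite -(big_mkord (fun i => m %| i)%N F) -(big_mkord xpredT (fun i => F (m * i)%N)).
elim: k => [|k IH]; first by rewrite muln0 big_mkcond !big_nat1 dvdn0 muln0.
(* The block m k < i <= m (k + 1) contributes only its last index. *)
rewrite [RHS]big_nat_recr //= -IH (@big_cat_nat _ _ _ (m * k).+1) //=; last by nia.
congr (_ + _); rewrite mulnS big_mkcond big_nat_recr /=; last by nia.
rewrite big1_seq ?add0r; first by rewrite -mulnS dvdn_mulr.
move=> i; rewrite mem_index_iota => /andP[_ /andP[h1 h2]].
case: ifP => // /dvdnP[x hx]; move: h1 h2.
by rewrite -mulnS hx (mulnC x) !ltn_pmul2l // ltnS; case: ltnP.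
Qed.

(** * Dunkl operators *)

Lemma primitive_root_neq0 (C : fieldType) m (w : C) : m.-primitive_root w -> w != 0.
Proof.
move=> hw; apply/eqP => e; have := prim_expr_order hw.
rewrite e expr0n gtn_eqF ?(prim_order_gt0 hw) //.
by move/eqP; rewrite eq_sym oner_eq0.
Qed.

Section DunklOperators.
Variables (C : numClosedFieldType) (m : nat) (zeta c : C).
Implicit Types (p q f g : P2 C) (a b : C) (i j k d e : nat).
Local Notation mon := (mon C).
Local Notation Y := (DY m zeta c).
Local Notation Yb := (DYbar m zeta c).

Lemma coef2_dz p i j : coef2 (dz p) i j = coef2 p i.+1 j *+ i.+1.
Proof. by rewrite /coef2 coef_deriv coefMn. Qed.
Lemma coef2_dzb p i j : coef2 (dzb p) i j = coef2 p i j.+1 *+ j.+1.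
Proof. by rewrite /coef2 coef_map_id0 ?deriv0 // coef_deriv. Qed.
Lemma dzbE p : dzb p = swapXY (dz (swapXY p)).
Proof. by apply: P2_eqP => i j; rewrite coef2_swap coef2_dz coef2_swap coef2_dzb. Qed.
Lemma dzD p q : dz (p + q) = dz p + dz q. Proof. exact: derivD. Qed.
Lemma dzZ a p : dz (cst a * p) = cst a * dz p.
Proof. by rewrite /dz derivM derivC mul0r add0r. Qed.
Lemma dzM p q : dz (p * q) = dz p * q + p * dz q. Proof. exact: derivM. Qed.
Lemma dz_mon i j : dz (mon i j) = cst i%:R * mon i.-1 j.
Proof.
apply: P2_eqP => k l; rewrite coef2_dz coef2_cstM !coef2_mon.
case: i => [|i]; first by rewrite mul0r mul0rn.
by rewrite eqSS /=; case: eqP => [->|_] /=; rewrite ?mulr0 ?mul0rn // mulr_natl -!mulrnA mulnC.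
Qed.
Lemma swap_cst a : swapXY (cst a) = cst a.
Proof. by rewrite swapXY_polyC map_polyC. Qed.
Lemma swap_z : swapXY (zv C) = zbv C. Proof. exact: swapXY_X. Qed.
Lemma swap_zb : swapXY (zbv C) = zv C. Proof. exact: swapXY_Y. Qed.
Lemma swap_mon i j : swapXY (mon i j) = mon j i.
Proof. by apply: P2_eqP => k l; rewrite coef2_swap !coef2_mon andbC. Qed.
Lemma swapD p q : swapXY (p + q) = swapXY p + swapXY q.
Proof. exact: rmorphD. Qed.
Lemma swapN p : swapXY (- p) = - swapXY p.
Proof. exact: (raddfN (@swapXY C)). Qed.
Lemma swapM p q : swapXY (p * q) = swapXY p * swapXY q.
Proof. exact: rmorphM. Qed.
Lemma homog_swap d p : homog d p -> homog d (swapXY p).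
Proof. by move=> h i j ij; rewrite coef2_swap h // addnC. Qed.

Lemma euler_dz d p : homog d p -> zv C * dz p + zbv C * dzb p = cst d%:R * p.
Proof.
move=> hp; apply: P2_eqP => i j; rewrite coef2D coef2_zM coef2_zbM coef2_cstM.
have -> : d%:R * coef2 p i j = (i + j)%:R * coef2 p i j.
  by case: (eqVneq (i + j)%N d) => [->|ij] //; rewrite hp ?mulr0.
rewrite natrD mulrDl; congr (_ + _).
  by case: i => [|i]; rewrite ?mul0r // coef2_dz mulr_natl.
by case: j => [|j]; rewrite ?mul0r // coef2_dzb mulr_natl.
Qed.

Hypothesis hz : m.-primitive_root zeta.
Let m0 : (0 < m)%N. Proof. exact: prim_order_gt0 hz. Qed.
Let z0 : zeta != 0. Proof. exact: primitive_root_neq0 hz. Qed.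
(** zeta^-1 = zeta^(m-1) with m - 1 prime to m. The inverse root governs negative powers of [zeta]
    and the exchange of z and zb. *)
Lemma primitive_rootV : m.-primitive_root zeta^-1.
Proof.
have -> : zeta^-1 = zeta ^+ m.-1.
  by apply: (mulfI z0); rewrite divff // -exprS prednK // (prim_expr_order hz).
by rewrite (prim_root_exp_coprime _ hz) coprime_sym coprimenP.
Qed.
Local Notation D := (divdiff zeta).
Local Notation s_ := (refl zeta).

Lemma DYE p : Y p = dz p - cst c * \sum_(j < m) D j p.
Proof. by []. Qed.
Lemma DYbE p : Yb p = dzb p - cst c * \sum_(j < m) cst (zeta ^+ j) * D j p.
Proof.
rewrite /DYbar; congr (_ - _ * _); apply: eq_bigr => j _.
exact: divdiffbE.
Qed.

Lemma DYD p q : Y (p + q) = Y p + Y q.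
Proof.
rewrite !DYE dzD; under eq_bigr => j _ do rewrite divdiffD //.
by rewrite big_split /=; ring.
Qed.
Lemma DYZ a p : Y (cst a * p) = cst a * Y p.
Proof.
rewrite !DYE dzZ; under eq_bigr => j _ do rewrite divdiffZ //.
by rewrite -mulr_sumr; ring.
Qed.
Lemma DY0 : Y 0 = 0.
Proof. by rewrite -[0 in LHS](mul0r 0) -cst0 DYZ cst0 mul0r. Qed.
Lemma DY_sum (I : Type) (r : seq I) (P : pred I) (F : I -> P2 C) :
  Y (\sum_(x <- r | P x) F x) = \sum_(x <- r | P x) Y (F x).
Proof. exact: (big_morph Y DYD DY0). Qed.

(* The last sum is what makes Y fail to be a derivation; each of its terms is
   anti-invariant under the corresponding reflection. *)
Lemma DYM p q : Y (p * q) = Y p * q + p * Y q +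
  cst c * \sum_(j < m) alpha zeta j * D j p * D j q.
Proof.
rewrite !DYE dzM; under eq_bigr => j _ do rewrite divdiffM //.
rewrite sumrB big_split /= -mulr_suml -mulr_sumr; ring.
Qed.

(** Since D_j(zb) = zeta^-j cancels the factor zeta^j in Ybar, this is the commutation relation
    [Ybar, zb] = 1 - c sum_j s_j. *)
Lemma DYbM_zb p : Yb (zbv C * p) = p + zbv C * Yb p - cst c * \sum_(j < m) s_ j p.
Proof.
rewrite !DYbE; have -> : dzb (zbv C * p) = p + zbv C * dzb p.
  rewrite !dzbE rmorphM /= swap_zb dzM {1}/dz derivX mul1r rmorphD rmorphM /=.
  by rewrite swapXYK swap_z.
have E j : cst (zeta ^+ j) * D j (zbv C * p) = s_ j p + zbv C * (cst (zeta ^+ j) * D j p).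
  have h : cst (zeta ^+ j) * cst (zeta ^- j) = 1 by rewrite -cstM divff ?cst1 ?expf_neq0.
  have -> : D j (zbv C * p) = cst (zeta ^- j) * s_ j p + zbv C * D j p.
    rewrite divdiffM //; have -> : D j (zbv C) = cst (zeta ^- j).
      apply: divdiffE => //; rewrite refl_zb opprK /alpha mulrDl mulrAC h; ring.
    have -> : s_ j p = p - alpha zeta j * D j p by rewrite divdiffK //; ring.
    ring.
  by rewrite mulrDr mulrA h mul1r; ring.
under eq_bigr => j _ do rewrite E.
rewrite big_split /= -mulr_sumr; ring.
Qed.

(** Euler's identity handles the derivatives, and (z + zeta^j zb) D_j(p) = p - s_j(p) handles the
    difference parts. *)
Lemma euler_Dunkl d p : homog d p ->
  zv C * Y p + zbv C * Yb p = cst d%:R * p - cst c * \sum_(j < m) (p - s_ j p).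
Proof.
move=> hp; rewrite -(euler_dz hp) DYE DYbE.
under [X in _ = _ - _ * X]eq_bigr => j _ do rewrite -divdiffK // /alpha mulrDl.
rewrite big_split /= -mulr_sumr.
have -> : \sum_(i < m) cst (zeta ^+ i) * zbv C * D i p =
   zbv C * \sum_(j < m) cst (zeta ^+ j) * D j p.
  by rewrite mulr_sumr; apply: eq_bigr => j _; ring.
ring.
Qed.

(** The reflection sums in the commutation relation and in Euler's identity cancel, leaving a
    scalar. *)
Lemma DYb_zb_add_z_DY d p : homog d p ->
  Yb (zbv C * p) + zv C * Y p = cst (d.+1%:R - c * m%:R) * p.
Proof.
move=> hp; rewrite DYbM_zb.
have := euler_Dunkl hp; rewrite sumrB sumr_const card_ord => h.
transitivity (p - cst c * \sum_(j < m) s_ j p + (zv C * Y p + zbv C * Yb p)); first by ring.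
rewrite h -[p *+ m]mulr_natl -!cst_nat -natr1 !(cstD, cstN, cstM) cst1; ring.
Qed.

Lemma DY_mon_ge k d : Y (mon (k + d) k) = cst (k + d)%:R * mon (k + d).-1 k -
  cst (c * m%:R) *
    \sum_(i < d | (m %| i)%N) cst ((-1) ^+ i) * mon (k + (d.-1 - i)) (k + i).
Proof.
rewrite DYE dz_mon cstM -mulrA; congr (_ - _ * _).
under eq_bigr => j _ do rewrite divdiff_mon_ge //.
rewrite exchange_big mulr_sumr [RHS]big_mkcond; apply: eq_bigr => i _ /=.
under eq_bigr => j _ do rewrite cstM -mulrA.
rewrite -mulr_sumr -mulr_suml -cst_sum (sum_primitive_root _ hz).
by case: ifP => _; rewrite ?cst0; ring.
Qed.

(** The terms of [divdiff_mon_le] carry zeta^(-j(i+1)), so summing over j keeps those with m | i + 1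
    instead of m | i. *)
Lemma DY_mon_le k d : Y (mon k (k + d)) = cst k%:R * mon k.-1 (k + d) -
  cst (c * m%:R) *
    \sum_(i < d | (m %| i.+1)%N) cst ((-1) ^+ i) * mon (k + i) (k + (d.-1 - i)).
Proof.
rewrite DYE dz_mon cstM -mulrA; congr (_ - _ * _).
under eq_bigr => j _ do rewrite divdiff_mon_le //.
rewrite exchange_big mulr_sumr [RHS]big_mkcond; apply: eq_bigr => i _ /=.
under eq_bigr => j _ do rewrite cstM -mulrA -exprVn.
rewrite -mulr_sumr -mulr_suml -cst_sum (sum_primitive_root _ primitive_rootV).
by case: ifP => _; rewrite ?cst0; ring.
Qed.

Lemma homogDY d p : homog d.+1 p -> homog d (Y p).
Proof.
have S (P : nat -> bool) e (F : nat -> C) (u v : nat -> nat) :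
    (forall i, (i < e)%N -> u i + v i = d)%N ->
    homog d (\sum_(i < e | P i) cst (F i) * mon (u i) (v i)).
  move=> h; apply: homog_sum => i _; apply: homogZ.
  by rewrite -(h i) //; apply: homog_mon.
(* For [i = 0] the predecessor would give the wrong degree, but then the coefficient [a *+ i] is
   zero. *)
have T a i j : (i + j = d.+1)%N -> homog d (cst (a *+ i) * mon i.-1 j).
  case: i => [|i] ij; first by rewrite cst0 mul0r; apply: homog0.
  by apply: homogZ; have -> : d = (i + j)%N by [lia]; apply: homog_mon.
elim/homog_ind => [|p1 p2 h1 h2|a i j ij]; first by rewrite DY0; apply: homog0.
  by rewrite DYD; apply: homogD.
rewrite DYZ; apply: homogZ; case: (leqP j i) => hij.
  have -> : i = (j + (i - j))%N by rewrite subnKC.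
  rewrite DY_mon_ge; apply: homogD; first by apply: (T 1); lia.
  apply/homogN/homogZ.
  apply: (S (fun i => m %| i)%N _ _ (fun k => j + ((i - j).-1 - k))%N (fun k => j + k)%N).
  by move=> k hk; lia.
have -> : j = (i + (j - i))%N by rewrite subnKC // ltnW.
rewrite DY_mon_le; apply: homogD; first by apply: (T 1); lia.
apply/homogN/homogZ.
apply: (S (fun i => m %| i.+1)%N _ _ (fun k => i + k)%N (fun k => i + ((j - i).-1 - k))%N).
by move=> k hk; lia.
Qed.

Lemma DY_cst a : Y (cst a) = 0.
Proof.
by rewrite -[cst a]mulr1 -(mon00 C) DYZ (DY_mon_ge 0 0) big_ord0 cst0; ring.
Qed.

(** The terms surviving in [DY_mon_ge] and [DY_mon_le] are spaced by m. So Y respects the grading by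
    the exponent of z modulo m, which keeps the number of equations small in [singular_value]. *)
Lemma coef2_DY_mon i j k l : (i != k.+1 %[mod m])%N -> coef2 (Y (mon i j)) k l = 0.
Proof.
move=> hik.
have N a u v : coef2 (cst a * mon u v) k l != 0 -> k = u.
  rewrite coef2_cstM coef2_mon; case: (eqVneq k u) => //= _; by rewrite mulr0 eqxx.
have T : coef2 (cst i%:R * mon i.-1 j) k l = 0.
  case: i hik => [|i] hik; first by rewrite cst0 mul0r coef20.
  by apply: contraNeq hik => /N /= ->.
case: (leqP j i) => hij.
  have E : i = (j + (i - j))%N by rewrite subnKC.
  rewrite E DY_mon_ge coef2D -E T.
  rewrite add0r coef2N coef2_cstM coef2_sum big1 ?mulr0 ?oppr0 // => x hx.
  apply: contraNeq hik => /N e; rewrite -(eqn_modDl x).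
  have -> : (x + k.+1)%N = i by have := ltn_ord x; lia.
  by case/dvdnP: hx => y ->; rewrite modnMDl.
have E : j = (i + (j - i))%N by rewrite subnKC // ltnW.
rewrite E DY_mon_le coef2D -E T.
rewrite add0r coef2N coef2_cstM coef2_sum big1 ?mulr0 ?oppr0 // => x hx.
apply: contraNeq hik => /N ->; rewrite -addnS.
by case/dvdnP: hx => y ->; rewrite addnC modnMDl.
Qed.

End DunklOperators.

(** * Exchange of z and zb, relating Y and Ybar *)

Lemma refl_swap (C : numClosedFieldType) (zeta : C) j p :
  refl zeta^-1 j (swapXY p) = swapXY (refl zeta j p).
Proof.
apply: (@rmorph_P2_ext C _ (refl zeta^-1 j \o swapXY) (swapXY \o refl zeta j)) => /=.
- by move=> a; rewrite swap_cst !refl_cst swap_cst.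
- by rewrite swap_z refl_zb refl_z swapN swapM swap_cst swap_zb exprVn invrK.
- by rewrite swap_zb refl_zb refl_z swapN swapM swap_cst swap_z exprVn.
Qed.

Lemma divdiff_swap (C : numClosedFieldType) (zeta : C) j p : zeta != 0 ->
  divdiff zeta^-1 j (swapXY p) = swapXY (cst (zeta ^+ j) * divdiff zeta j p).
Proof.
move=> z0; have h : cst (zeta ^- j) * cst (zeta ^+ j) = 1.
  by rewrite -cstM mulVf ?cst1 ?expf_neq0.
apply: divdiffE; rewrite ?invr_eq0 // refl_swap -swapN -swapD -divdiffK //.
have -> : alpha zeta^-1 j = swapXY (zbv C + cst (zeta ^- j) * zv C).
  by rewrite swapD swapM swap_cst swap_z swap_zb /alpha exprVn.
rewrite -swapM; congr swapXY; rewrite mulrA; congr (_ * _).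
rewrite /alpha mulrDl mulrAC h; ring.
Qed.

Section DunklConjugate.
Variables (C : numClosedFieldType) (m : nat) (zeta c : C).
Hypothesis hz : m.-primitive_root zeta.
Implicit Types (p q f g : P2 C) (a b : C) (i j k d e : nat).
Local Notation Yb := (DYbar m zeta c).

(** Transfers to Ybar the properties of Y, which are proved for every primitive root: exchanging the
    variables inverts [zeta]. *)
Lemma DYbar_swap p : Yb p = swapXY (DY m zeta^-1 c (swapXY p)).
Proof.
have z0 : zeta != 0.
  by rewrite -invr_eq0 (primitive_root_neq0 (primitive_rootV hz)).
rewrite (DYbE _ hz) DYE swapD swapN swapM swap_cst -dzbE (rmorph_sum (@swapXY _)).
congr (_ - _ * _); apply: eq_bigr => j _.
by rewrite divdiff_swap //; symmetry; apply: swapXYK.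
Qed.

Lemma DYbD p q : Yb (p + q) = Yb p + Yb q.
Proof. by rewrite !DYbar_swap swapD (DYD _ (primitive_rootV hz)) swapD. Qed.
Lemma DYbZ a p : Yb (cst a * p) = cst a * Yb p.
Proof.
by rewrite !DYbar_swap swapM swap_cst (DYZ _ (primitive_rootV hz)) swapM swap_cst.
Qed.
Lemma homogDYb d p : homog d.+1 p -> homog d (Yb p).
Proof.
move=> hp; rewrite DYbar_swap; apply: homog_swap.
by apply: (homogDY _ (primitive_rootV hz)); apply: homog_swap.
Qed.
End DunklConjugate.

(** * The circle functional *)

Section Functional.
Variables (C : numClosedFieldType) (t : nat -> nat -> C).
Implicit Types (p q : P2 C).

Definition lam p : C := \sum_(i < size p) \sum_(j < sizeY p) coef2 p i j * t i j.

(** The sum may run over any box containing the support, so several polynomials can be compared on a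
    common box. *)
Lemma lamE K p : (size p <= K)%N -> (sizeY p <= K)%N ->
  lam p = \sum_(i < K) \sum_(j < K) coef2 p i j * t i j.
Proof.
move=> h1 h2; rewrite /lam (big_ord_widen K (fun i => \sum_(j < sizeY p) coef2 p i j * t i j) h1).
rewrite big_mkcond; apply: eq_bigr => i _; case: ltnP => hi.
  rewrite (big_ord_widen K (fun j => coef2 p i j * t i j) h2) big_mkcond.
  apply: eq_bigr => j _; case: ltnP => // hj.
  by rewrite /coef2 nth_default ?mul0r // (leq_trans (max_size_coefXY p i)).
by rewrite big1 // => j _; rewrite /coef2 (nth_default 0 hi) coef0 mul0r.
Qed.

Lemma lamD p q : lam (p + q) = lam p + lam q.
Proof.
pose s (r : P2 C) := maxn (size r) (sizeY r).
pose K := maxn (s (p + q)) (maxn (s p) (s q)).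
rewrite !(@lamE K) ?/K ?/s ?leq_max ?leqnn ?orbT //.
rewrite -big_split; apply: eq_bigr => i _; rewrite -big_split; apply: eq_bigr => j _.
by rewrite coef2D mulrDl.
Qed.
Lemma lamZ a p : lam (cst a * p) = a * lam p.
Proof.
pose s (r : P2 C) := maxn (size r) (sizeY r).
pose K := maxn (s (cst a * p)) (s p).
rewrite !(@lamE K) ?/K ?/s ?leq_max ?leqnn ?orbT // mulr_sumr; apply: eq_bigr => i _.
by rewrite mulr_sumr; apply: eq_bigr => j _; rewrite coef2_cstM mulrA.
Qed.
Lemma lam0 : lam 0 = 0.
Proof. by rewrite -[0 in LHS](mul0r 0) -cst0 lamZ mul0r. Qed.
Lemma lamN p : lam (- p) = - lam p.
Proof. by rewrite -mulN1r -cst1 -cstN lamZ mulN1r. Qed.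
Lemma lam_sum (I : Type) (r : seq I) (P : pred I) (F : I -> P2 C) :
  lam (\sum_(x <- r | P x) F x) = \sum_(x <- r | P x) lam (F x).
Proof. exact: (big_morph lam lamD lam0). Qed.
Lemma lam_mon i j : lam (mon C i j) = t i j.
Proof.
set K := maxn (maxn (size (mon C i j)) (sizeY (mon C i j))) (maxn i.+1 j.+1).
have hi : (i < K)%N by rewrite !leq_max leqnn !orbT.
have hj : (j < K)%N by rewrite !leq_max leqnn !orbT.
rewrite (@lamE K) ?leq_max ?leqnn ?orbT //.
rewrite (bigD1 (Ordinal hi)) //= (bigD1 (Ordinal hj)) //= coef2_mon !eqxx mul1r.
rewrite !big1 ?addr0 //.
  move=> k ki; rewrite big1 // => l _.
  have /negPf kn : (nat_of_ord k != i) by apply: contra ki => /eqP e; apply/eqP/val_inj.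
  by rewrite coef2_mon kn mul0r.
move=> l lj; rewrite coef2_mon.
have /negPf -> : (nat_of_ord l != j) by apply: contra lj => /eqP e; apply/eqP/val_inj.
by rewrite andbF mul0r.
Qed.
Lemma lam_swap p : (forall i j, t i j = t j i) -> lam (swapXY p) = lam p.
Proof.
move=> ts; elim/P2_ind: p => [|p q hp hq|a i j]; first by rewrite raddf0.
  by rewrite swapD !lamD hp hq.
by rewrite swapM swap_cst swap_mon !lamZ !lam_mon ts.
Qed.
End Functional.

(** * Summation identities for the moments *)

Section CircleFunctional.
Variables (C : numClosedFieldType) (m : nat) (c : C) (n : nat).
Implicit Types (p q f g : P2 C) (a b : C) (i j k d e s : nat).

(* twt i j = Lambda(z^i zb^j); junk for |i - j| > 2n, where wt m c may have a zero
   denominator. *)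
Definition distn i j : nat := (i - j + (j - i))%N.
Definition wtd k : C := if (m %| k)%N then wt m c (k %/ m) else 0.
Definition twt i j : C := if odd (i + j) then 0 else wtd (distn i j)./2.

Lemma twtC i j : twt i j = twt j i.
Proof. by rewrite /twt /distn addnC [(i - j + _)%N]addnC. Qed.
Lemma twtE i j k : distn i j = k.*2 -> twt i j = wtd k.
Proof.
rewrite /twt /distn => h; rewrite (_ : odd (i + j) = false) ?h ?doubleK //.
by lia.
Qed.
Lemma twtSS i j : twt i.+1 j.+1 = twt i j.
Proof. by rewrite /twt /distn !subSS addSn addnS /= negbK. Qed.

Hypothesis m0 : (0 < m)%N.
Hypothesis hc : forall k : nat, (1 <= k <= n %/ m)%N -> c != k%:R.

Let v k : C := (\prod_(i < k) (c + i%:R)) / \prod_(i < k) (i.+1%:R - c).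
Let wtE k : wt m c k = (-1) ^+ (m * k) * v k.
Proof. by rewrite /wt /v mulrA. Qed.
Let vS k : (k < n %/ m)%N -> v k.+1 * (k.+1%:R - c) = v k * (c + k%:R).
Proof.
move=> hk; have h : k.+1%:R - c != 0 by rewrite subr_eq0 eq_sym hc.
rewrite /v !big_ord_recr /= invfM.
by rewrite mulrA mulfVK //; ring.
Qed.

(** Going from k to k + 1 recentres the sum and adds v(k+1) at both ends; the recursion [vS] closes
    the induction. *)
Let sum_v k : (k <= n %/ m)%N ->
  c * \sum_(i < (k.*2).+1) v (distn k i) = (k%:R + c) * v k.
Proof.
elim: k => [|k IH] hk; first by rewrite double0 big_ord1 add0r.
rewrite doubleS big_ord_recr big_ord_recl /=.
under eq_bigr => i _ do rewrite /bump /= add1n /distn !subSS -/(distn k i).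
rewrite !mulrDr IH ?(ltnW hk) //.
have -> : distn k.+1 0 = k.+1 by rewrite /distn; lia.
have -> : distn k.+1 (k.*2.+2) = k.+1 by rewrite /distn; lia.
have := vS hk; rewrite -natr1 => h.
transitivity (v k.+1 * (k%:R + 1 - c) + 2 * c * v k.+1); last by ring.
by rewrite h; ring.
Qed.

(** Unless m | e, no i satisfies both m | i and m | |e - i|, so both sides vanish. For e = mk only
    multiples of m remain, and [sum_v] applies. *)
Lemma sum_wtd e : (e <= n)%N ->
  c * m%:R * (\sum_(i < e.*2.+1 | (m %| i)%N) (-1) ^+ i * wtd (distn e i)) =
  (e%:R + c * m%:R) * wtd e.
Proof.
move=> he; case: (boolP (m %| e)%N) => hme; last first.
  rewrite {2}/wtd (negPf hme) mulr0 big1 ?mulr0 // => i hi.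
  rewrite /wtd; case: ifP => h; last by rewrite mulr0.
  exfalso; apply: (negP hme).
  rewrite /distn in h; case/orP: (leq_total e i) => hei.
    by rewrite -(dvdn_subr hei hi); move: h; rewrite (eqP (hei : (e - i)%N == 0%N)).
  by move: h; rewrite (eqP (hei : (i - e)%N == 0%N)) addn0 dvdn_subl.
have [k ek] := dvdnP hme; rewrite {}ek mulnC in he *.
have hk : (k <= n %/ m)%N by rewrite leq_divRL // mulnC.
rewrite doubleMr (@sum_dvdn _ m k.*2 (fun i => (-1) ^+ i * wtd (distn (m * k) i))) //.
have E i : (-1) ^+ (m * i) * wtd (distn (m * k) (m * i)) = (-1) ^+ (m * k) * v (distn k i).
  have -> : distn (m * k) (m * i) = (m * distn k i)%N by rewrite /distn mulnDr !mulnBr.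
  rewrite /wtd dvdn_mulr // mulKn // wtE mulrA -exprD; congr (_ * _).
  (* The signs agree because i + |k - i| and k have the same parity. *)
  rewrite -signr_odd -[RHS]signr_odd; congr (_ ^+ nat_of_bool _).
  by rewrite -mulnDr /distn !oddM; congr (_ && _); lia.
under eq_bigr => i _ do rewrite E.
rewrite -mulr_sumr /wtd dvdn_mulr // mulKn // wtE mulrCA [c * _ * _]mulrAC sum_v // natrM; ring.
Qed.

(** This is [sum_wtd] at e + 1 with its two end terms, each equal to [wtd e.+1], moved to the right;
    the index shift flips the sign. *)
Lemma sum_wtd_shift e : (e < n)%N ->
  c * m%:R * (\sum_(i < e.*2.+1 | (m %| i.+1)%N) (-1) ^+ i * wtd (distn e i)) =
  (c * m%:R - e.+1%:R) * wtd e.+1.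
Proof.
move=> he; have := sum_wtd he.
rewrite big_mkcond doubleS big_ord_recr big_ord_recl /=.
under eq_bigr => i _ do rewrite /bump /= add1n /distn !subSS -/(distn e i) exprS mulN1r mulNr.
have -> : distn e.+1 0 = e.+1 by rewrite /distn; lia.
have -> : distn e.+1 (e.*2.+2) = e.+1 by rewrite /distn; lia.
rewrite dvdn0 expr0 mul1r -[in (m %| e.*2.+2)%N]doubleS -[in (-1) ^+ e.*2.+2]doubleS.
rewrite -signr_odd odd_double mul1r.
(* The filter at the upper end is m | 2(e + 1), weaker than m | e + 1, but [wtd e.+1] is zero when
   the latter fails. *)
have -> : (if (m %| e.+1.*2)%N then wtd e.+1 else 0) = wtd e.+1.
  case: ifP => // h; rewrite /wtd; case: ifP => // h'.
  by rewrite -muln2 dvdn_mulr in h.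
move=> h; rewrite [in LHS]big_mkcond /=; set S' := (\sum_(i < _) _ in LHS).
have h2 : c * m%:R * (wtd e.+1 - S' + wtd e.+1) = (e.+1%:R + c * m%:R) * wtd e.+1.
  rewrite -h; congr (_ * (_ + _)); congr (_ + _).
  by rewrite /S' -sumrN; apply: eq_bigr => i _; case: ifP => _; rewrite ?oppr0.
transitivity (2 * (c * m%:R) * wtd e.+1 - c * m%:R * (wtd e.+1 - S' + wtd e.+1)).
  by ring.
by rewrite h2; ring.
Qed.
End CircleFunctional.

(** * Integration by parts for the Dunkl operators *)

Section DunklAdjoint.
Variables (C : numClosedFieldType) (m : nat) (c : C) (n : nat).
Hypothesis hc : forall k : nat, (1 <= k <= n %/ m)%N -> c != k%:R.
Implicit Types (p q f g : P2 C) (a b zeta : C) (i j k d e s : nat).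
Local Notation L := (lam (twt m c)).
Let kap s : C := s%:R - c * m%:R.

Lemma lam_zzb p : L (zv C * (zbv C * p)) = L p.
Proof.
elim/P2_ind: p => [|p q hp hq|a i j]; first by rewrite !mulr0.
  by rewrite !mulrDr !lamD hp hq.
by rewrite !(mulrCA _ (cst a)) zbmon zmon !lamZ !lam_mon twtSS.
Qed.

(** A reflection exchanges the two exponents up to a sign and a power of [zeta]. A nonzero moment
    forces their difference to be even and divisible by m, and then both factors are trivial. *)
Lemma lam_refl zeta j p : m.-primitive_root zeta -> L (refl zeta j p) = L p.
Proof.
move=> hz; have z0 := primitive_root_neq0 hz.
elim/P2_ind: p => [|p q hp hq|a k l]; first by rewrite rmorph0.
  by rewrite rmorphD /= !lamD hp hq.
rewrite rmorphM /= refl_cst refl_mon // !lamZ !lam_mon (twtC _ _ l k); congr (_ * _).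
rewrite /twt -signr_odd; case: ifP => [_|hodd]; first by rewrite mulr0.
rewrite expr0 mul1r /wtd; case: ifP => [h|_]; last by rewrite mulr0.
suff -> : zeta ^+ (j * k) = zeta ^+ (j * l) by rewrite divff ?mul1r ?expf_neq0.
apply/eqP; rewrite (eq_prim_root_expr hz).
have {}h : (m %| distn k l)%N.
  have -> : distn k l = ((distn k l)./2 * 2)%N by rewrite /distn; lia.
  exact: dvdn_mulr.
case/orP: (leq_total k l) => hkl.
  rewrite eq_sym eqn_mod_dvd ?leq_mul2l ?hkl ?orbT // -mulnBr dvdn_mull //.
  by move: h; rewrite /distn (eqP (hkl : (k - l)%N == 0%N)).
rewrite eqn_mod_dvd ?leq_mul2l ?hkl ?orbT // -mulnBr dvdn_mull //.
by move: h; rewrite /distn (eqP (hkl : (l - k)%N == 0%N)) addn0.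
Qed.

Lemma lam_antiinv zeta j p : m.-primitive_root zeta -> refl zeta j p = - p -> L p = 0.
Proof.
move=> hz h; have := lam_refl j p hz; rewrite h lamN => /eqP.
by rewrite eq_sym -subr_eq0 opprK -mulr2n mulrn_eq0 => /eqP.
Qed.

(** The last sum of [DYM] disappears: alpha_j is anti-invariant and the divided differences are
    invariant, so [lam_antiinv] applies. *)
Lemma lam_DYM zeta p q : m.-primitive_root zeta ->
  L (DY m zeta c (p * q)) = L (DY m zeta c p * q) + L (p * DY m zeta c q).
Proof.
move=> hz; have z0 := primitive_root_neq0 hz.
rewrite DYM // !lamD lamZ lam_sum big1 ?mulr0 ?addr0 // => j _.
apply: (@lam_antiinv zeta j) => //.
by rewrite !rmorphM /= !refl_divdiff // refl_alpha // !mulNr.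
Qed.

(** The bounds on i keep every index of [wtd] that occurs at most n, where the denominators are
    nonzero. The case j < i rests on [sum_wtd], the other on [sum_wtd_shift]. *)
Lemma lam_DY_mon zeta i j s : m.-primitive_root zeta ->
  (i + j).+1 = s.*2 -> (i <= s + n)%N -> (s <= i + n)%N ->
  L (DY m zeta c (mon C i j)) = kap s * twt m c i j.+1.
Proof.
move=> hz hs h1 h2; have m0 := prim_order_gt0 hz; case: (ltnP j i) => hij.
  pose e := (i - s)%N; have Ei : i = (j + e.*2.+1)%N by rewrite /e; lia.
  have Es : s = (j + e.+1)%N by lia.
  rewrite (twtE _ _ (k := e)); last by rewrite /distn; lia.
  rewrite [in LHS]Ei (DY_mon_ge _ hz) lamD lamN !lamZ lam_sum.
  rewrite (eq_bigr (fun k : 'I_(e.*2.+1) => (-1) ^+ k * wtd m c (distn e k))); last first.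
    move=> k _; rewrite lamZ lam_mon (twtE _ _ (k := distn e k)) //.
    by have := ltn_ord k; rewrite /distn; lia.
  rewrite (sum_wtd m0 hc) //; last by rewrite /e; lia.
  rewrite lam_mon (twtE _ _ (k := e)); last by rewrite /distn; lia.
  by rewrite /kap Es !addnS -!natr1 !natrD -addnn natrD; ring.
have [e Es] : exists e, s = (i + e.+1)%N by exists (s - i).-1; lia.
have Ej : j = (i + e.*2.+1)%N by lia.
rewrite [in LHS]Ej (DY_mon_le _ hz) lamD lamN !lamZ lam_sum.
rewrite (eq_bigr (fun k : 'I_(e.*2.+1) => (-1) ^+ k * wtd m c (distn e k))); last first.
  move=> k _; rewrite lamZ lam_mon (twtE _ _ (k := distn e k)) //.
  by have := ltn_ord k; rewrite /distn; lia.
rewrite (sum_wtd_shift m0 hc) //; last by lia.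
rewrite (twtE _ _ (k := e.+1)) /distn; last by lia.
(* For [i = 0] the truncated exponent is harmless because the factor [i%:R] is zero. *)
have -> : i%:R * L (mon C i.-1 (i + e.*2.+1)) = i%:R * wtd m c e.+1.
  case: i {hs h1 h2 hij Ej Es} => [|i]; first by rewrite !mul0r.
  by rewrite lam_mon (twtE _ _ (k := e.+1)) // /distn; lia.
rewrite /kap Es natrD; ring.
Qed.

Lemma lam_DY zeta p s : m.-primitive_root zeta -> (0 < s <= n)%N ->
  homog s.*2.-1 p -> L (DY m zeta c p) = kap s * L (zbv C * p).
Proof.
move=> hz hs; elim/homog_ind => [|f g hf hg|a i j ij].
- by rewrite DY0 // mulr0 !lam0 mulr0.
- rewrite DYD // (lamD _ (DY _ _ _ f)) hf hg (mulrDr (zbv C)) (lamD _ (zbv C * f)).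
  by rewrite mulrDr.
rewrite DYZ // (mulrCA (zbv C)) zbmon !lamZ lam_mon (@lam_DY_mon _ _ _ s) //; try lia.
ring.
Qed.

(** Reaches the index s + 1 = n + 1, one beyond [lam_DY]: the factor z excludes the monomial
    zb^(2n+1), whose weight index n + 1 is not covered by [hc]. *)
Lemma lam_DY_z zeta p s : m.-primitive_root zeta -> (s <= n)%N ->
  homog s.*2 p -> L (DY m zeta c (zv C * p)) = kap s.+1 * L p.
Proof.
move=> hz hs; elim/homog_ind => [|f g hf hg|a i j ij].
- by rewrite mulr0 DY0 // !lam0 mulr0.
- rewrite mulrDr DYD // (lamD _ (DY _ _ _ (zv C * f))) hf hg (lamD _ f).
  by rewrite mulrDr.
rewrite (mulrCA (zv C)) zmon DYZ // !lamZ lam_mon (@lam_DY_mon _ _ _ s.+1) //; try lia.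
rewrite twtSS; ring.
Qed.

(** The moments are symmetric, so this and the next two lemmas follow by exchanging z and zb. *)
Lemma lam_DYbM zeta p q : m.-primitive_root zeta ->
  L (DYbar m zeta c (p * q)) = L (DYbar m zeta c p * q) + L (p * DYbar m zeta c q).
Proof.
move=> hz; have hz' := primitive_rootV hz.
rewrite !DYbar_swap // swapM (lam_swap _ (twtC m c)) lam_DYM //.
by congr (_ + _); rewrite -(lam_swap _ (twtC m c)) swapM swapXYK.
Qed.

Lemma lam_DYb zeta p s : m.-primitive_root zeta -> (0 < s <= n)%N ->
  homog s.*2.-1 p -> L (DYbar m zeta c p) = kap s * L (zv C * p).
Proof.
move=> hz hs hp; rewrite DYbar_swap // (lam_swap _ (twtC m c)).
rewrite (@lam_DY _ _ s) //; [| exact: primitive_rootV | exact: homog_swap].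
by rewrite -swap_z -swapM (lam_swap _ (twtC m c)).
Qed.

Lemma lam_DYb_zb zeta p s : m.-primitive_root zeta -> (s <= n)%N ->
  homog s.*2 p -> L (DYbar m zeta c (zbv C * p)) = kap s.+1 * L p.
Proof.
move=> hz hs hp; rewrite DYbar_swap // (lam_swap _ (twtC m c)) swapM swap_zb.
rewrite (@lam_DY_z _ _ s) //; [| exact: primitive_rootV | exact: homog_swap].
by rewrite (lam_swap _ (twtC m c)).
Qed.
End DunklAdjoint.

(** * Orthogonality and nondegeneracy *)

Lemma common_zero_linear_forms (F : fieldType) a b (f : 'I_b -> 'rV[F]_a -> F) :
  (forall i x v w, f i (x *: v + w) = x * f i v + f i w) -> (b < a)%N ->
  exists2 v, v != 0 & forall i, f i v = 0.
Proof.
move=> lf ab; pose g v : 'rV[F]_b := \row_i f i v.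
have lg : linear g by move=> x v w; apply/rowP => i; rewrite !mxE lf.
pose gl : {linear 'rV[F]_a -> 'rV[F]_b} :=
  HB.pack g (GRing.isLinear.Build _ _ _ _ g lg).
have : kermx (lin1_mx gl) != 0.
  by rewrite kermx_eq0 /row_free neq_ltn (leq_ltn_trans (rank_leq_col _)).
case/rowV0Pn => v /sub_kermxP; rewrite mul_rV_lin1 => hv v0; exists v => // i.
by move/rowP/(_ i): hv; rewrite !mxE.
Qed.

Lemma linear_surjective (F : fieldType) a (f : 'rV[F]_a -> 'rV[F]_a) :
  linear f -> (forall v, f v = 0 -> v = 0) -> forall w, exists v, f v = w.
Proof.
move=> lf inj w.
pose fl : {linear 'rV[F]_a -> 'rV[F]_a} :=
  HB.pack f (GRing.isLinear.Build _ _ _ _ f lf).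
have u : lin1_mx fl \in unitmx.
  rewrite -row_free_unit -kermx_eq0; apply: contraT.
  case/rowV0Pn => v /sub_kermxP hv /negP[]; apply/eqP/inj.
  by rewrite -hv mul_rV_lin1.
by exists (w *m invmx (lin1_mx fl)); rewrite -[LHS](mul_rV_lin1 fl) mulmxKV.
Qed.

Section Orthogonality.
Variables (C : numClosedFieldType) (m : nat) (zeta c : C) (n : nat).
Hypothesis hz : m.-primitive_root zeta.
Hypothesis hreg : regular m zeta c.
Hypothesis hc : forall k : nat, (1 <= k <= n %/ m)%N -> c != k%:R.
Implicit Types (p q f g h : P2 C) (a b : C) (i j k d e l s : nat).
Local Notation L := (lam (twt m c)).
Local Notation Y := (DY m zeta c).
Local Notation Yb := (DYbar m zeta c).
Let m0 : (0 < m)%N. Proof. exact: prim_order_gt0 hz. Qed.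
Let z0 : zeta != 0. Proof. exact: primitive_root_neq0 hz. Qed.

(** On these monomials zeta^(jmk) = 1, and the remaining powers zeta^(-j(s-mk)) sum to zero because
    m does not divide s - mk. *)
Lemma sum_refl_class s k : ~~ (m %| s)%N -> (m * k <= s)%N ->
  \sum_(j < m) refl zeta j (mon C (m * k) (s - m * k)) = 0.
Proof.
move=> hs hk; under eq_bigr => j _ do rewrite refl_mon //.
rewrite -mulr_suml -cst_sum.
under eq_bigr => j _ do rewrite mulnCA exprM (prim_expr_order hz) expr1n mulr1 -exprVn.
rewrite -mulr_sumr (sum_primitive_root _ (primitive_rootV hz)) ifN ?mulr0 ?cst0 ?mul0r //.
by rewrite -(subnK hk) dvdn_addl ?dvdn_mulr in hs.
Qed.

(* For m not dividing s, if c = s/m then Y has a kernel on the span of the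
   z^(mk) zb^(s-mk); by Euler's identity Ybar kills it as well, because the
   reflections average to zero on this span. *)
Lemma singular_value s : ~~ (m %| s)%N -> c * m%:R != s%:R.
Proof.
move=> hs; apply/eqP => hcs; pose K := (s %/ m)%N.
have hK k : (k < K.+1)%N -> (m * k <= s)%N.
  by rewrite ltnS /K leq_divRL // mulnC.
pose u (v : 'rV[C]_K.+1) : P2 C :=
  \sum_(k < K.+1) cst (v 0 k) * mon C (m * k) (s - m * k).
have uE v k (hk : (k < K.+1)%N) : coef2 (u v) (m * k) (s - m * k) = v 0 (Ordinal hk).
  rewrite /u coef2_sum (bigD1 (Ordinal hk)) //= coef2_cstM coef2_mon !eqxx mulr1.
  rewrite big1 ?addr0 // => i ik; rewrite coef2_cstM coef2_mon eqn_pmul2l //.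
  have /negPf -> : k != i by apply: contra ik => /eqP e; apply/eqP/val_inj.
  by rewrite mulr0.
have uh v : homog s (u v).
  apply: homog_sum => k _; apply: homogZ.
  by rewrite -[X in homog X _](subnKC (hK k (ltn_ord k))); apply: homog_mon.
have uD a v w : u (a *: v + w) = cst a * u v + u w.
  rewrite /u mulr_sumr -big_split; apply: eq_bigr => k _.
  by rewrite !mxE cstD cstM mulrDl mulrA.
have s0 : (0 < s)%N by case: (s) hs; rewrite ?dvdn0.
(* Nonzero coefficients of [Y (u v)] can occur only at exponents m(i + 1) - 1 of z below s: K
   equations for K + 1 unknowns. *)
have [v v0 fv] : exists2 v : 'rV[C]_K.+1, v != 0 &
    forall i : 'I_K, coef2 (Y (u v)) (m * i.+1).-1 (s - m * i.+1) = 0.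
  apply: common_zero_linear_forms => // i a v w.
  by rewrite uD DYD // DYZ // coef2D coef2_cstM.
have Yu : Y (u v) = 0.
  apply: P2_eqP => k l; rewrite coef20.
  case: (eqVneq (k + l)%N s.-1) => kl; last first.
    have hY : homog s.-1 (Y (u v)) by apply: homogDY => //; rewrite (prednK s0).
    by rewrite hY.
  case: (boolP (m %| k.+1)%N) => [/dvdnP[[|x] hx]|hk] //.
    have hxK : (x < K)%N.
      by rewrite /K leq_divRL // -hx -(prednK s0) ltnS -kl leq_addr.
    move: (fv (Ordinal hxK)); rewrite /= mulnC -hx /=.
    by have -> : (s - k.+1)%N = l by lia.
  rewrite /u DY_sum // coef2_sum big1 // => i _.
  rewrite DYZ // coef2_cstM coef2_DY_mon ?mulr0 //.
  by rewrite modnMr eq_sym.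
have Ybu : Yb (u v) = 0.
  apply: (mulfI (_ : zbv C != 0)); first by rewrite polyC_eq0 polyX_eq0.
  have := euler_Dunkl c hz (uh v); rewrite Yu !mulr0 add0r => ->.
  rewrite sumrB sumr_const card_ord -[u v *+ m]mulr_natl -cst_nat.
  have -> : \sum_(j < m) refl zeta j (u v) = 0.
    under eq_bigr => j _ do rewrite /u rmorph_sum /=.
    rewrite exchange_big big1 // => k _.
    under eq_bigr => j _ do rewrite rmorphM /= refl_cst.
    by rewrite -mulr_sumr sum_refl_class ?mulr0 // hK.
  by rewrite subr0 mulrA -cstM hcs subrr.
have u0 := hreg s0 (uh v) Yu Ybu; case/eqP: v0; apply/rowP => -[k hk].
by rewrite mxE -uE u0 coef20.
Qed.

Lemma kappa_neq0 s : (0 < s <= n)%N -> s%:R - c * m%:R != 0.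
Proof.
case/andP=> s0 sn; rewrite subr_eq0 eq_sym.
case: (boolP (m %| s)%N) => [/dvdnP[k ek]|]; last exact: singular_value.
rewrite ek natrM; apply: contraNneq (hc (k := k) _).
  by move/mulIf => -> //; rewrite pnatr_eq0 -lt0n.
by rewrite leq_divRL // -ek sn andbT lt0n; apply: contraTneq s0 => e; rewrite ek e.
Qed.

(** With 2s = n + 1 + l, [L (Y g * Yb h)] is integrated by parts once in Y and once in Ybar.
    Comparing the results through [DYb_zb_add_z_DY] gives (s - l) L(gh) = 0, and l < s. *)
Lemma lam_orthogonal h l g : homog n.+1 h -> Y (Yb h) = 0 ->
  homog l g -> (l < n)%N -> ~~ odd (n.+1 + l) -> L (g * h) = 0.
Proof.
move=> hh Fh; elim/ltn_ind: l g => l IH g hg ln hodd.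
have [s hs] : exists s, (n.+1 + l)%N = s.*2 by exists (n.+1 + l)./2; lia.
have sn : (0 < s <= n)%N by lia.
have k0 := kappa_neq0 sn.
have hYb : homog n (Yb h) by apply: homogDYb.
have E1 : L (Y g * Yb h) = (s%:R - c * m%:R) * L (zbv C * (g * Yb h)).
  rewrite -(lam_DY hc hz sn) ?lam_DYM ?Fh ?mulr0 ?lam0 ?addr0 //.
  by have -> : s.*2.-1 = (l + n)%N by [lia]; apply: homogM.
have E2 : (s.+1%:R - c * m%:R) * L (g * h) = L (Yb (zbv C * g) * h) + L (zbv C * g * Yb h).
  rewrite -lam_DYbM // -mulrA (lam_DYb_zb hc hz (s := s)) //; first by lia.
  by rewrite -hs addnC; apply: homogM.
(* Integration in Ybar produces [L (Yb (Y g) * h)], zero by induction since the degree drops by two;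
   for l < 2 its left factor is already zero. *)
have E3 : L (Y g * Yb h) = (s%:R - c * m%:R) * L (zv C * (Y g * h)).
  case: l => [|l] in IH hg ln hodd hs *.
    by rewrite (homog0E hg) DY_cst // !mul0r mulr0 lam0 mulr0.
  have hYg : homog l (Y g) by apply: homogDY.
  rewrite -(lam_DYb hc hz sn); last first.
    by have -> : s.*2.-1 = (l + n.+1)%N by [lia]; apply: homogM.
  rewrite lam_DYbM // (_ : L (Yb (Y g) * h) = 0) ?add0r //.
  case: l => [|l] in IH hYg ln hodd hs hg *.
    by rewrite (homog0E hYg) DYbar_swap // swap_cst DY_cst ?raddf0 ?mul0r ?lam0 //; exact: primitive_rootV.
  by apply: (IH l) => //; [exact: homogDYb | lia | lia].
have E4 := DYb_zb_add_z_DY c hz hg.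
have E5 : L (Yb (zbv C * g) * h) + L (zv C * (Y g * h)) = (l.+1%:R - c * m%:R) * L (g * h).
  by rewrite mulrA -lamD -mulrDl E4 -mulrA lamZ.
have E6 : L (zv C * (Y g * h)) = L (zbv C * g * Yb h).
  by apply: (mulfI k0); rewrite -E3 E1 mulrA.
have : (s.+1%:R - l.+1%:R) * L (g * h) = 0.
  transitivity ((s.+1%:R - c * m%:R) * L (g * h) - (l.+1%:R - c * m%:R) * L (g * h)).
    by ring.
  by rewrite E2 -E5 E6 subrr.
move/eqP; rewrite mulf_eq0 subr_eq0 eqr_nat => /orP[e|/eqP //]; lia.
Qed.

(** For g in the radical in degree l + 1 and f of degree l, both L(zb f g) and L((Y f) g) vanish, so
    integration by parts leaves L(f Y g) = 0. By induction Y g = 0, likewise Ybar g = 0, and [hreg]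
    applies. *)
Lemma lam_nondegenerate l g : (l <= n)%N -> homog l g ->
  (forall f, homog l f -> L (f * g) = 0) -> g = 0.
Proof.
elim: l g => [|l IH] g ln hg ort.
  rewrite (homog0E hg); move: (ort (mon C 0 0) (@homog_mon C 0 0)).
  rewrite mon00 mul1r {1}(homog0E hg) -[cst _]mulr1 -mon00 lamZ lam_mon.
  rewrite (twtE _ _ (k := 0)) // /wtd dvdn0 div0n /wt !big_ord0 muln0 expr0 divr1 !mulr1.
  by move=> ->; rewrite cst0 mul0r.
have hs : (0 < l.+1 <= n)%N by [].
(* The factor z zb, invisible to [L], raises Y f from degree l - 1 to the test degree l + 1; for l =
   0, Y f is zero. *)
have D f : homog l f -> homog l.+1 (zv C * (zbv C * Y f)) /\ homog l.+1 (zv C * (zbv C * Yb f)).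
  case: l {IH ln hg ort hs} => [|l] hf.
    rewrite (homog0E hf) DY_cst // DYbar_swap // swap_cst DY_cst; last exact: primitive_rootV.
    by rewrite raddf0 !mulr0; split; apply: homog0.
  by split; apply: homog_z; apply: homog_zb; [apply: homogDY | apply: homogDYb].
have fg f : homog l f -> homog l.+1.*2.-1 (f * g).
  by move=> hf; have -> : l.+1.*2.-1 = (l + l.+1)%N by [lia]; apply: homogM.
apply: (hreg (ltn0Sn l) hg); apply: (IH _ (ltnW ln)).
- exact: homogDY.
- move=> f hf; have := lam_DYM c f g hz.
  rewrite (lam_DY hc hz hs (fg f hf)) (mulrA (zbv C)) ort ?mulr0; last exact: homog_zb.
  rewrite -[L (Y f * g)]lam_zzb !mulrA -(mulrA (zv C)) ort ?add0r //.
  by case: (D f hf).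
- exact: homogDYb.
- move=> f hf; have := lam_DYbM c f g hz.
  rewrite (lam_DYb hc hz hs (fg f hf)) (mulrA (zv C)) ort ?mulr0; last exact: homog_z.
  rewrite -[L (Yb f * g)]lam_zzb !mulrA -(mulrA (zv C)) ort ?add0r //.
  by case: (D f hf).
Qed.
End Orthogonality.

(** * Dehomogenization *)

Section Dehomogenization.
Variable C : numClosedFieldType.
Implicit Types (p h : P2 C) (q : {poly C}) (a b : C) (i j k d e l : nat).

(** Inverse to setting zb = 1. Coefficients above degree d are discarded, hence the size bound in
    [hgzK]. *)
Definition hgz d q : P2 C := \sum_(i < d.+1) cst q`_i * mon C i (d - i).
Definition dehom p : {poly C} := map_poly (horner_eval 1) p.

Lemma homog_hgz d q : homog d (hgz d q).
Proof.
apply: homog_sum => i _; apply: homogZ.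
have e : (i + (d - i))%N = d by rewrite subnKC // -ltnS.
by rewrite -{1}e; apply: homog_mon.
Qed.
Lemma dehomD p h : dehom (p + h) = dehom p + dehom h.
Proof. exact: rmorphD. Qed.
Lemma dehomM p h : dehom (p * h) = dehom p * dehom h.
Proof. exact: rmorphM. Qed.
Lemma dehom0 : dehom 0 = 0.
Proof. exact: rmorph0. Qed.
Lemma dehom_cst a : dehom (cst a) = a%:P.
Proof. by rewrite /dehom map_polyC /= /horner_eval hornerC. Qed.
Lemma dehom_z : dehom (zv C) = 'X.
Proof. exact: map_polyX. Qed.
Lemma dehom_zb : dehom (zbv C) = 1.
Proof. by rewrite /dehom map_polyC /= /horner_eval hornerX. Qed.
Lemma dehom_mon i j : dehom (mon C i j) = 'X^i.
Proof. by rewrite /mon dehomM /dehom !rmorphXn /= -!/(dehom _) dehom_z dehom_zb expr1n mulr1. Qed.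

Lemma dehomE d p : homog d p -> dehom p = \poly_(i < d.+1) coef2 p i (d - i).
Proof.
move=> hp; rewrite poly_def {1}(homogE hp) /dehom rmorph_sum; apply: eq_bigr => i _ /=.
by rewrite -/(dehom _) dehomM dehom_cst dehom_mon mul_polyC.
Qed.
Lemma size_dehom d p : homog d p -> (size (dehom p) <= d.+1)%N.
Proof. by move/dehomE ->; apply: size_poly. Qed.
Lemma dehom_inj d p h : homog d p -> homog d h -> dehom p = dehom h -> p = h.
Proof.
move=> hp hh; rewrite (dehomE hp) (dehomE hh) => /polyP e.
rewrite (homogE hp) (homogE hh); apply: eq_bigr => i _; congr (cst _ * _).
by have := e i; rewrite !coef_poly ltn_ord.
Qed.
Lemma hgzK d q : (size q <= d.+1)%N -> dehom (hgz d q) = q.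
Proof.
move=> hq; have -> : dehom (hgz d q) = \poly_(i < d.+1) q`_i.
  rewrite poly_def /hgz /dehom rmorph_sum; apply: eq_bigr => i _ /=.
  by rewrite -/(dehom _) dehomM dehom_cst dehom_mon mul_polyC.
by apply/polyP => i; rewrite coef_poly; case: ltnP => // h; rewrite nth_default // (leq_trans hq).
Qed.
End Dehomogenization.

(** * phi as the restriction of the circle functional to degree 2n *)

Section CharacteristicFunctional.
Variables (C : numClosedFieldType) (m : nat) (c : C) (n : nat).
Hypothesis m0 : (0 < m)%N.
Implicit Types (p q : P2 C) (a : C) (i j k d : nat).

Lemma phiD p q : phi m c n (p + q) = phi m c n p + phi m c n q.
Proof.
rewrite /phi coef2D addrACA -big_split; congr (_ + _); apply: eq_bigr => k _.
by rewrite /= !coef2D -mulrDr addrACA.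
Qed.
Lemma phiZ a p : phi m c n (cst a * p) = a * phi m c n p.
Proof.
rewrite /phi coef2_cstM mulrDr mulr_sumr; congr (_ + _); apply: eq_bigr => k _.
by rewrite !coef2_cstM -mulrDr mulrCA.
Qed.
(** In the range of summation mk <= n, so no subtraction truncates and every coefficient read has
    total degree 2n. *)
Lemma phi_homog d p : homog d p -> d != (2 * n)%N -> phi m c n p = 0.
Proof.
move=> hp dn; rewrite /phi hp ?add0r; last by rewrite addnn -mul2n eq_sym.
rewrite big1_seq // => k; rewrite mem_index_iota => /andP[_ /andP[_]].
rewrite ltnS leq_divRL // mulnC => hk.
have e1 : (n - m * k + (n + m * k))%N = (2 * n)%N by lia.
by rewrite !hp ?addr0 ?mulr0 // ?e1 ?[(n + _ + _)%N]addnC ?e1 eq_sym.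
Qed.

Lemma phi_mon i j : (i + j = 2 * n)%N -> phi m c n (mon C i j) = twt m c i j.
Proof.
move=> ij; pose d := distn i n.
rewrite (twtE _ _ (k := d)); last by rewrite /d /distn; lia.
rewrite /phi coef2_mon; case: (eqVneq d 0%N) => hd.
  have [-> ->] : i = n /\ j = n by rewrite /d /distn in hd; lia.
  rewrite hd eqxx /wtd dvdn0 div0n /wt !big_ord0 muln0 expr0 divr1 mulr1.
  rewrite big1_seq ?addr0 // => k; rewrite mem_index_iota => /andP[_ /andP[k0 _]].
  have hk : (0 < m * k)%N by rewrite muln_gt0 m0.
  rewrite !coef2_mon (_ : (n + m * k == n)%N = false) ?andbF ?addr0 ?mulr0 //; lia.
rewrite (_ : (n == i) = false) ?add0r /=; last by apply/eqP; rewrite /d /distn in hd; lia.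
(* Since d > 0, exactly one of the two coefficients is 1 when mk = d, and none otherwise. *)
transitivity (\sum_(1 <= k < (n %/ m).+1) wt m c k * (m * k == d)%N%:R).
  apply: eq_big_seq => k; rewrite mem_index_iota ltnS leq_divRL // mulnC => /andP[k0 hk].
  congr (_ * _); rewrite !coef2_mon -natrD; congr (_%:R); move: (m * k)%N hk => x hk.
  rewrite /d /distn in hd *; lia.
rewrite /wtd; case: ifP => [/dvdnP[k hk]|hm]; last first.
  rewrite big1_seq // => k _; case: eqP => [e|]; last by rewrite mulr0.
  by rewrite -e dvdn_mulr in hm.
have hkq : (1 <= k < (n %/ m).+1)%N.
  rewrite ltnS leq_divRL // -hk; apply/andP; split; last by rewrite /d /distn; lia.
  by rewrite lt0n; apply: contra_neq hd => e; rewrite hk e.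
rewrite hk mulnK // (bigD1_seq k) ?mem_index_iota ?iota_uniq //=.
rewrite mulnC eqxx mulr1 big1 ?addr0 // => x xk.
by rewrite mulnC eqn_pmul2r // (negPf xk) mulr0.
Qed.

Lemma phiE p : homog (2 * n) p -> phi m c n p = lam (twt m c) p.
Proof.
elim/homog_ind => [|f g hf hg|a i j ij].
- by rewrite lam0; apply: (@phi_homog (2 * n).+1); [apply: homog0 | lia].
- by rewrite phiD lamD hf hg.
- by rewrite phiZ lamZ phi_mon // lam_mon.
Qed.
End CharacteristicFunctional.

(** * The ideal of quasiharmonic polynomials *)

Section CompleteIntersection.
Variables (C : numClosedFieldType) (t : nat -> nat -> C) (l : nat).
Local Notation n := l.+1.
Local Notation L := (lam t).
Implicit Types (p f g h : P2 C) (q : {poly C}) (a b : C).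
Hypothesis nondegenerate : forall g, homog n g ->
  (forall f, homog n f -> L (f * g) = 0) -> g = 0.
Variables (h1 h2 : P2 C).
Hypotheses (hom1 : homog n.+1 h1) (hom2 : homog n.+1 h2).
Hypothesis free : forall a b, cst a * h1 + cst b * h2 = 0 -> a = 0 /\ b = 0.
Hypotheses (ort1 : forall g, homog l g -> L (g * h1) = 0)
           (ort2 : forall g, homog l g -> L (g * h2) = 0).
Local Notation H1 := (dehom h1).
Local Notation H2 := (dehom h2).

(* If ell divides h1 and h2, both quotients are orthogonal to a hyperplane of
   the forms of degree n, so a nonzero combination of them is orthogonal to all. *)
Lemma no_common_factor ell w g1 g2 :
  (forall f, homog n f -> exists f' a, homog l f' /\ f = ell * f' + cst a * w) ->
  homog n g1 -> homog n g2 -> h1 = ell * g1 -> h2 = ell * g2 -> False.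
Proof.
move=> dec hg1 hg2 e1 e2.
have [a [b [ab0 abL]]] : exists a b, ~ (a = 0 /\ b = 0) /\ a * L (w * g1) + b * L (w * g2) = 0.
  case: (eqVneq (L (w * g2)) 0) => [->|w2].
    by exists 0, 1; rewrite mul0r mulr0 addr0; split=> // -[_ /eqP]; rewrite oner_eq0.
  exists (L (w * g2)), (- L (w * g1)); split; last by ring.
  by case=> e; rewrite e eqxx in w2.
apply: ab0; apply: free.
suff -> : cst a * h1 + cst b * h2 = ell * (cst a * g1 + cst b * g2).
  rewrite (nondegenerate (g := cst a * g1 + cst b * g2)) ?mulr0 //.
    by apply: homogD; apply: homogZ.
  move=> f /dec[f' [x [hf' ->]]].
  have -> : (ell * f' + cst x * w) * (cst a * g1 + cst b * g2) =
      cst a * (f' * h1) + cst b * (f' * h2) +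
      cst x * (cst a * (w * g1) + cst b * (w * g2)) by rewrite e1 e2; ring.
  by rewrite lamD lamD !lamZ ort1 // ort2 // lamD !lamZ abL !mulr0 !addr0.
by rewrite e1 e2; ring.
Qed.

(** Setting zb = 1 hides a common factor zb, except that both degrees drop; this lemma excludes that
    factor. *)
Lemma size_dehom_pair : (size H1 == n.+2) || (size H2 == n.+2).
Proof.
have s1 := size_dehom hom1; have s2 := size_dehom hom2.
apply: contraT; rewrite negb_or => /andP[d1 d2]; exfalso.
have {d1} s1 : (size H1 <= n.+1)%N by move: s1; rewrite leq_eqVlt (negPf d1).
have {d2} s2 : (size H2 <= n.+1)%N by move: s2; rewrite leq_eqVlt (negPf d2).
(* The forms of degree n are the multiples of zb plus the line spanned by z^n. *)
apply: (@no_common_factor (zbv C) (mon C n 0) (hgz n H1) (hgz n H2)).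
- move=> f hf; exists (hgz l (take_poly n (dehom f))), (dehom f)`_n.
  split; first exact: homog_hgz.
  apply: (@dehom_inj _ n) => //.
    apply: homogD; first exact/homog_zb/homog_hgz.
    by apply: homogZ; have := @homog_mon C n 0; rewrite addn0.
  rewrite dehomD dehomM dehom_zb mul1r dehomM dehom_cst dehom_mon hgzK ?size_take_poly //.
  apply/polyP => i; rewrite coefD coef_take_poly coefCM coefXn.
  case: (ltngtP i n) => [|hi|->]; rewrite ?mulr0 ?addr0 ?mulr1 ?add0r //.
  by rewrite nth_default // (leq_trans (size_dehom hf)).
- exact: homog_hgz.
- exact: homog_hgz.
- apply: (dehom_inj hom1); first exact/homog_zb/homog_hgz.
  by rewrite dehomM dehom_zb mul1r hgzK.
- apply: (dehom_inj hom2); first exact/homog_zb/homog_hgz.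
  by rewrite dehomM dehom_zb mul1r hgzK.
Qed.

(** Otherwise the gcd has a root x, the field being algebraically closed, and z - x zb divides both
    forms. *)
Lemma coprime_dehom : coprimep H1 H2.
Proof.
rewrite /coprimep; apply: contraT => /closed_rootP[x]; rewrite root_gcd => /andP[].
move=> /factor_theorem[G1 e1] /factor_theorem[G2 e2]; exfalso.
have sG d (G : {poly C}) : (size (G * ('X - x%:P))%R <= d.+1)%N -> (size G <= d)%N.
  case: (eqVneq G 0) => [->|G0]; first by rewrite size_poly0.
  by rewrite size_Mmonic ?monicXsubC // size_XsubC addn2.
have s1 : (size G1 <= n.+1)%N by apply: sG; rewrite -e1; apply: size_dehom.
have s2 : (size G2 <= n.+1)%N by apply: sG; rewrite -e2; apply: size_dehom.
have hell d g : homog d g -> homog d.+1 ((zv C - cst x * zbv C) * g).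
  rewrite mulrBl -mulrA => hg; apply: homogD; first exact: homog_z.
  exact/homogN/homogZ/homog_zb.
have dell : dehom (zv C - cst x * zbv C) = 'X - x%:P.
  by rewrite -mulNr -cstN dehomD dehomM dehom_cst dehom_zb dehom_z mulr1 rmorphN.
(* Modulo z - x zb, a form f of degree n is congruent to f(x, 1) zb^n. *)
apply: (@no_common_factor (zv C - cst x * zbv C) (mon C 0 n) (hgz n G1) (hgz n G2)).
- move=> f hf.
  have /factor_theorem[G eG] : root (dehom f - (dehom f).[x]%:P) x.
    by rewrite /root !hornerE subrr.
  have sF : (size G <= n)%N.
    apply: sG; rewrite -eG (leq_trans (size_polyD _ _)) // geq_max size_dehom //.
    by rewrite size_polyN (leq_trans (size_polyC_leq1 _)).
  exists (hgz l G), (dehom f).[x]; split; first exact: homog_hgz.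
  apply: (@dehom_inj _ n) => //.
    by apply: homogD; [apply/hell/homog_hgz | apply: homogZ; exact: (@homog_mon C 0 n)].
  by rewrite dehomD dehomM dell dehomM dehom_cst dehom_mon hgzK // mulr1 mulrC -eG subrK.
- exact: homog_hgz.
- exact: homog_hgz.
- apply: (dehom_inj hom1); first exact/hell/homog_hgz.
  by rewrite dehomM dell hgzK // e1 mulrC.
- apply: (dehom_inj hom2); first exact/hell/homog_hgz.
  by rewrite dehomM dell hgzK // e2 mulrC.
Qed.

(** Say [H1] has full degree n + 1. Being coprime to [H2] it divides V, whose degree is smaller, so
    V = 0 and then U = 0. *)
Lemma no_syzygy (U V : {poly C}) : (size U <= n)%N -> (size V <= n)%N ->
  U * H1 + V * H2 = 0 -> U = 0 /\ V = 0.
Proof.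
move=> sU sV e; have cop := coprime_dehom.
have key (A B P Q : {poly C}) : size P = n.+2 -> coprimep P Q -> (size B <= n)%N ->
    A * P + B * Q = 0 -> A = 0 /\ B = 0.
  move=> sP cPQ sB eAB.
  have P0 : P != 0 by rewrite -size_poly_gt0 sP.
  have B0 : B = 0.
    apply: contraTeq sB => B0; rewrite -ltnNge.
    have : P %| B.
      rewrite -(Gauss_dvdpl _ cPQ); apply/dvdpP; exists (- A).
      by rewrite mulNr; apply/eqP; rewrite -addr_eq0 addrC eAB.
    by move/(dvdp_leq B0); rewrite sP => /ltnW.
  move: eAB; rewrite B0 mul0r addr0 => /eqP.
  by rewrite mulf_eq0 (negPf P0) orbF => /eqP ->.
case/orP: size_dehom_pair => /eqP s; first exact: (key _ _ _ _ s cop sV e).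
rewrite coprimep_sym in cop; rewrite addrC in e.
by have [] := key _ _ _ _ s cop sU e.
Qed.

(** The map from (u, v, a) to u h1 + v h2 + a z^n zb^n goes between spaces of dimension 2n + 1. As
    [L] reads off a, [no_syzygy] makes it injective, hence surjective; and L p = 0 forces a = 0. *)
Lemma kernel_sub_ideal p : t n n = 1 -> homog (2 * n) p -> L p = 0 ->
  exists u v, p = u * h1 + v * h2.
Proof.
move=> tn hp Lp.
have hom2n u : homog l u -> homog (2 * n) (u * h1) /\ homog (2 * n) (u * h2).
  by move=> hu; have -> : (2 * n)%N = (l + n.+1)%N by [lia]; split; apply: homogM.
have hnn : homog (2 * n) (mon C n n) by rewrite mul2n -addnn; apply: homog_mon.
pose N := (n + n + 1)%N.
(* The vector [r] splits into blocks of lengths n, n and 1 encoding u, v and a; the value is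
   recorded by its dehomogenization. *)
pose f (r : 'rV[C]_N) : 'rV[C]_N := poly_rV
  (rVpoly (lsubmx (lsubmx r)) * H1 + rVpoly (rsubmx (lsubmx r)) * H2
   + (rsubmx r 0 0)%:P * 'X^n).
have back r : let u := hgz l (rVpoly (lsubmx (lsubmx r))) in
    let v := hgz l (rVpoly (rsubmx (lsubmx r))) in
    let q := u * h1 + v * h2 + cst (rsubmx r 0 0) * mon C n n in
    [/\ homog (2 * n) q, rVpoly (f r) = dehom q & L q = rsubmx r 0 0].
  move=> u v q; have hu : homog l u by apply: homog_hgz.
  have hv : homog l v by apply: homog_hgz.
  have hq : homog (2 * n) q.
    apply: homogD; last exact: homogZ.
    by apply: homogD; [case: (hom2n u hu) | case: (hom2n v hv)].
  have dq : dehom q = rVpoly (lsubmx (lsubmx r)) * H1 + rVpoly (rsubmx (lsubmx r)) * H2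
       + (rsubmx r 0 0)%:P * 'X^n.
    rewrite /q !dehomD (dehomM u) (dehomM v) (dehomM (cst _)) dehom_cst dehom_mon.
    by rewrite /u /v !hgzK ?size_poly.
  split=> //; last by rewrite /q !lamD ort1 // ort2 // !add0r lamZ lam_mon tn mulr1.
  rewrite /f -dq poly_rV_K // (leq_trans (size_dehom hq)) // /N; lia.
have lf : linear f.
  move=> x r s; rewrite /f -linearP; congr poly_rV.
  rewrite !linearP /= !mxE rmorphD rmorphM /= -!mul_polyC; ring.
have injf r : f r = 0 -> r = 0.
  move=> fr; have [hq dq Lq] := back r.
  set q := _ + _ in hq dq Lq.
  have q0 : q = 0.
    apply: (dehom_inj hq); first exact: homog0.
    by rewrite -dq fr raddf0 dehom0.
  rewrite q0 lam0 in Lq.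
  have := congr1 (@dehom C) q0; rewrite /q -Lq cst0 mul0r addr0 dehomD !dehomM.
  rewrite dehom0 !hgzK ?size_poly // => /no_syzygy[]; rewrite ?size_poly //.
  move=> U0 V0; rewrite -[r]hsubmxK -[lsubmx r]hsubmxK.
  rewrite -[lsubmx (lsubmx r)](@rVpolyK _ n) U0 -[rsubmx (lsubmx r)](@rVpolyK _ n) V0.
  rewrite !raddf0 (_ : rsubmx r = 0) ?row_mx0 //.
  by apply/matrixP => i j; rewrite !ord1 -Lq mxE.
have [r fr] := linear_surjective lf injf (poly_rV (dehom p)).
have [hq dq Lq] := back r; set q := _ + _ in hq dq Lq.
have qp : p = q.
  apply: (dehom_inj hp hq); rewrite -dq fr poly_rV_K //.
  by rewrite (leq_trans (size_dehom hp)) // /N; lia.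
exists (hgz l (rVpoly (lsubmx (lsubmx r)))), (hgz l (rVpoly (rsubmx (lsubmx r)))).
by rewrite qp /q -Lq -qp Lp cst0 mul0r addr0.
Qed.
End CompleteIntersection.

(** * Existence of quasiharmonic polynomials *)

Section QuasiHarmonic.
Variables (C : numClosedFieldType) (m : nat) (zeta c : C) (l : nat).
Local Notation n := l.+1.
Hypothesis hz : m.-primitive_root zeta.

Lemma exists_quasiharmonic i0 : (i0 < n.+2)%N -> exists h i1,
  [/\ (i1 < n.+2)%N, QH m zeta c n.+1 h, coef2 h i0 (n.+1 - i0) = 0 &
      coef2 h i1 (n.+1 - i1) != 0].
Proof.
move=> hi0.
pose u (v : 'rV[C]_n.+2) : P2 C := \sum_(k < n.+2) cst (v 0 k) * mon C k (n.+1 - k).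
have uE v k (hk : (k < n.+2)%N) : coef2 (u v) k (n.+1 - k) = v 0 (Ordinal hk).
  rewrite /u coef2_sum (bigD1 (Ordinal hk)) //= coef2_cstM coef2_mon !eqxx mulr1.
  rewrite big1 ?addr0 // => i ik; rewrite coef2_cstM coef2_mon.
  have /negPf -> : k != i by apply: contra ik => /eqP e; apply/eqP/val_inj.
  by rewrite mulr0.
have uh v : homog n.+1 (u v).
  apply: homog_sum => k _; apply: homogZ.
  have e : (k + (n.+1 - k))%N = n.+1 by rewrite subnKC // -ltnS.
  by rewrite -{1}e; apply: homog_mon.
have uD a v w : u (a *: v + w) = cst a * u v + u w.
  rewrite /u mulr_sumr -big_split; apply: eq_bigr => k _.
  by rewrite !mxE cstD cstM mulrDl mulrA.
have hF v : homog l (DF m zeta c (u v)).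
  exact/homogN/homogDY/homogDYb/uh.
(* There are n + 2 unknown coefficients and n + 1 equations: n for F u = 0, as F u has degree n - 1,
   and one for the prescribed zero. *)
have [v v0 fv] : exists2 v : 'rV[C]_n.+2, v != 0 & forall i : 'I_n.+1,
    (if (i < n)%N then coef2 (DF m zeta c (u v)) i (l - i) else coef2 (u v) i0 (n.+1 - i0)) = 0.
  apply: common_zero_linear_forms => // i a v w; rewrite uD.
  case: ifP => _; last by rewrite coef2D coef2_cstM.
  by rewrite /DF DYbD // DYD // DYbZ // DYZ // opprD -mulrN coef2D coef2_cstM.
have [i1 vi1] := rV0Pn _ v0.
exists (u v), i1; split=> //.
- split=> //; rewrite (homogE (hF v)) big1 // => i _.
  have := fv (widen_ord (leqnSn n) i); rewrite /= ltn_ord => ->.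
  by rewrite cst0 mul0r.
- by have := fv ord_max; rewrite ltnn.
- by case: i1 vi1 => i1 h1; rewrite uE.
Qed.

(** The second polynomial is made to vanish at an index where the first has a nonzero
    coefficient. *)
Lemma exists_quasiharmonic_pair : exists h1 h2,
  [/\ QH m zeta c n.+1 h1, QH m zeta c n.+1 h2 &
      forall a b, cst a * h1 + cst b * h2 = 0 -> a = 0 /\ b = 0].
Proof.
have [h1 [i1 [hi1 q1 _ n1]]] := exists_quasiharmonic (ltn0Sn n.+1).
have [h2 [i2 [hi2 q2 z2 n2]]] := exists_quasiharmonic hi1.
exists h1, h2; split=> // a b e.
have a0 : a = 0.
  have := coef2D (cst a * h1) (cst b * h2) i1 (n.+1 - i1).
  rewrite e coef20 !coef2_cstM z2 mulr0 addr0 => /esym/eqP.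
  by rewrite mulf_eq0 (negPf n1) orbF => /eqP.
split=> //; move: e; rewrite a0 cst0 mul0r add0r => e.
have := coef2_cstM b h2 i2 (n.+1 - i2); rewrite e coef20 => /esym/eqP.
by rewrite mulf_eq0 (negPf n2) orbF => /eqP.
Qed.
End QuasiHarmonic.

Theorem theorem2p26 (C : numClosedFieldType) (m : nat) (zeta c : C) (n : nat) :
  (2 <= m)%N -> m.-primitive_root zeta ->
  regular m zeta c ->
  (forall k : nat, (1 <= k <= n %/ m)%N -> c != k%:R) ->
  forall p : P2 C, homog (2 * n) p ->
    (inJ m zeta c n.+1 p <-> phi m c n p = 0).
Proof.
move=> m2 hz hreg hc p hp; have m0 := ltnW m2.
have ort h g l : QH m zeta c n.+1 h -> (l + n.+1 = 2 * n)%N -> homog l g ->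
    lam (twt m c) (g * h) = 0.
  case=> hh /eqP; rewrite oppr_eq0 => /eqP Fh e hg.
  by apply: (lam_orthogonal hz hreg hc hh Fh hg); lia.
split=> [[s [hs ->]]|].
  elim: s hs => [|x s IH] hs.
    by rewrite big_nil; apply: (@phi_homog _ _ _ _ m0 (2 * n).+1); [apply: homog0 | lia].
  rewrite big_cons phiD IH ?addr0 => [|y ys]; last by apply: hs; rewrite inE ys orbT.
  have {s IH hs} hx : QH m zeta c n.+1 x.2 by apply: hs; rewrite inE eqxx.
  (* The multiplier is arbitrary; linearity reduces it to a monomial, and only a product of total
     degree 2n can contribute to [phi]. *)
  have hh := hx.1; elim/P2_ind: x.1 => [|f g hf hg|a i j].
  - by rewrite mul0r; apply: (@phi_homog _ _ _ _ m0 (2 * n).+1); [apply: homog0 | lia].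
  - by rewrite mulrDl phiD hf hg addr0.
  have hij := @homog_mon C i j; rewrite -mulrA phiZ.
  have hmul := homogM hij hh; case: (eqVneq (i + j + n.+1)%N (2 * n)%N) => e.
    by rewrite phiE // -?e // (ort _ _ _ hx e hij) mulr0.
  by rewrite (phi_homog _ m0 hmul e) mulr0.
(* For n = 0 the vanishing of [phi] already gives p = 0, an empty combination; otherwise n = l +
   1. *)
case: n hc ort hp => [|l] hc ort hp hphi.
  exists [::]; split=> //; rewrite big_nil (homog0E hp).
  by move: hphi; rewrite /phi div0n big_geq // addr0 => ->; rewrite cst0.
have [h1 [h2 [q1 q2 free]]] := exists_quasiharmonic_pair c l hz.
have nondeg := lam_nondegenerate hz hreg hc (leqnn l.+1).
have hl : (l + l.+2 = 2 * l.+1)%N by lia.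
have [u [v ->]] : exists u v, p = u * h1 + v * h2.
  apply: (kernel_sub_ideal nondeg q1.1 q2.1 free _ _ _ hp).
  - by move=> g hg; apply: ort hg.
  - by move=> g hg; apply: ort hg.
  - rewrite (twtE _ _ (k := 0)) ?/distn ?subnn //.
    by rewrite /wtd dvdn0 div0n /wt !big_ord0 muln0 expr0 divr1 mulr1.
  - by rewrite -(phiE c m0 hp).
exists [:: (u, h1); (v, h2)]; split; last by rewrite !big_cons big_nil addr0.
by move=> x; rewrite in_cons mem_seq1 => /orP[] /eqP ->; [exact: q1 | exact: q2].
Qed.
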